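(* Let $A$ be an $n\times n$ complex matrix, $n\ge2$. Consider the $n\times n$ complex matrices $X$ that have no eigenvalues on $\mathbb{R}^-=\{x\in\mathbb{R}\mid x\le0\}$ and that satisfy $$XA-AX=\log(X).$$ The general solution of this equation is $X=I_n+N$, where $N$ is a nilpotent matrix that satisfies $$NA-AN=N+\sum_{i=2}^{n-1}\frac{(-1)^{i-1}}{i}N^i.$$ Moreover, if $A$ is given explicitly, then the solutions $N$ can be calculated, using the method of successive Sylvester equations described in the context.
   Context: For a matrix $X\in\mathcal{M}_n(\mathbb{C})$ with no eigenvalues on $\mathbb{R}^-$, $\log(X)$ denotes the principal logarithm: the $n\times n$ matrix $U$ such that $e^U=X$ and the eigenvalues of $U$ lie in the strip $\{z\in\mathbb{C}\mid \Im(z)\in(-\pi,\pi)\}$. Method of calculation of $N$. Write the spectrum of $A$ as a disjoint union of sets $B_r=\lambda_r+\{0,1,\dots,c_r\}$ ($\lambda_r\in\mathbb{C}$, $c_r\in\mathbb{N}$) such that $u-v\ne1$ whenever $u\in B_r$, $v\in B_s$, $r\ne s$. Take $P$ invertible with $P^{-1}AP=\bigoplus_rU_r$, where $U_r$ is a Jordan matrix with spectrum $B_r$. Then $P^{-1}NP=\bigoplus_rN_r$, where each $N_r$ is nilpotent and satisfies the same equation with $A$ replaced by $U_r$, or equivalently by $U_r-\lambda_rI$. This reduces the problem to a matrix of the form $\mathrm{diag}(n_1,I_{s_2}+n_2,\dots,(k-1)I_{s_k}+n_k)$ with each $n_j$ nilpotent of size $s_j$. In that case the solution is a strictly upper triangular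 $k\times k$ block matrix $[x_{ij}]$. Its blocks $x_{j,j+i}$ are found successively for $i=1,2,\dots,k-1$ by solving, for $1\le j\le k-i$, Sylvester equations (linear equations of the form $xB-Cx=D$). For $i=1$, $x_{j,j+1}$ is any solution of $x_{j,j+1}n_{j+1}-n_jx_{j,j+1}=0$. For $i\ge2$, $x_{j,j+i}((i-1)I_{s_{j+i}}+n_{j+i})-n_jx_{j,j+i}=\psi_{ij}$, where $\psi_{ij}$ is determined by the coefficients of the equation and the blocks already found. With $\nu(x)=xn_{j+i}-n_jx$ (a nilpotent operator), this gives $x_{j,j+i}=\big(\frac{1}{i-1}\mathrm{Id}-\frac{1}{(i-1)^2}\nu+\frac{1}{(i-1)^3}\nu^2-\cdots\big)\psi_{ij}$. *)

(* Defs.v *)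
From HB Require Import structures.
From mathcomp Require Import all_boot all_order all_algebra.
From mathcomp Require Import complex.
From mathcomp Require Import all_classical all_reals all_analysis.
Import Order.TTheory GRing.Theory Num.Theory numFieldNormedType.Exports.

Set Implicit Arguments.
Unset Strict Implicit.
Unset Printing Implicit Defensive.

Local Open Scope classical_set_scope.
Local Open Scope ring_scope.

(** ** Matrix exponential and principal logarithm *)

Definition expmx (R : realType) (n : nat) (U : 'M[R[i]]_n) : 'M[R[i]]_n :=
  limn (series (fun k : nat => (k`!%:R)^-1 *: U ^+ k)).

Definition no_eigenvalue_Rminus (R : realType) (n : nat) (X : 'M[R[i]]_n) :
    Prop :=
  forall x : R, x <= 0 -> ~~ eigenvalue X x%:C%C.

(* [U = log X].  The principal logarithm is given by its defining property,
   which determines [U] when [X] has no eigenvalue in R^-. *)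
Definition is_logmx (R : realType) (n : nat) (X U : 'M[R[i]]_n) : Prop :=
  expmx U = X /\
  forall z : R[i], eigenvalue U z -> - pi < complex.Im z < pi.

(** ** The equation satisfied by the nilpotent part *)

Definition nilpotent_mx (F : pzRingType) (q : nat) (N : 'M[F]_q) : Prop :=
  exists k : nat, N ^+ k = 0.

(* The part of degree >= 2 of the right-hand side.  The bound [n] is kept
   separate from the size [q], because the same equation is used for the
   diagonal blocks of a matrix of size [n]. *)
Definition higher_terms (F : numFieldType) (n q : nat) (N : 'M[F]_q) : 'M[F]_q :=
  \sum_(2 <= i < n) ((-1) ^+ (i - 1) / i%:R) *: N ^+ i.

Definition nil_solution (F : numFieldType) (n q : nat) (A N : 'M[F]_q) : Prop :=
  nilpotent_mx N /\ N *m A - A *m N = N + higher_terms n N.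

(** ** Splitting of the spectrum into chains *)

Definition jordan_block (F : pzRingType) (a : F) (q : nat) : 'M[F]_q :=
  \matrix_(i < q, j < q) (a *+ (i == j) + (i.+1 == j :> nat)%:R).

(* The Jordan matrix with the single eigenvalue [a] and Jordan blocks of
   sizes [t]. *)
Definition jordan_mx (F : pzRingType) (a : F) (t : seq nat) :
    'M[F]_(\sum_(l < size t) nth 0%N t l) :=
  \mxdiag_(l < size t) jordan_block a (nth 0%N t l).

(* [u] belongs to [lam + {0, 1, ..., c}]. *)
Definition in_chain (F : pzRingType) (lam : F) (c : nat) (u : F) : Prop :=
  exists2 i : nat, (i <= c)%N & u = lam + i%:R.

(* The Jordan matrix with spectrum [lam + {0, ..., c}] in which the eigenvalue
   [lam + j] has Jordan blocks of sizes [t j] ([t j] is irrelevant for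
   [j > c]). *)
Definition chain_jordan_mx (F : pzRingType) (lam : F) (c : nat)
    (t : nat -> seq nat) :
    'M[F]_(\sum_(j < c.+1) \sum_(l < size (t j)) nth 0%N (t j) l) :=
  \mxdiag_(j < c.+1) jordan_mx (lam + j%:R) (t j).

(* [P^-1 A P] is the direct sum of Jordan matrices whose spectra are chains.
   The invertible matrix [P] and its inverse [Q] are typed as [n x q] and
   [q x n] matrices, where [q] is the sum of the sizes of the Jordan blocks;
   [cd_PQ] and [cd_QP] force [q = n]. *)
Record chain_decomposition (F : fieldType) (n : nat) (A : 'M[F]_n) := {
  cd_m : nat;
  cd_lam : 'I_cd_m -> F;
  cd_c : 'I_cd_m -> nat;
  cd_t : 'I_cd_m -> nat -> seq nat;
  cd_P : 'M[F]_(n, \sum_(r < cd_m) \sum_(j < (cd_c r).+1)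
                     \sum_(l < size (cd_t r j)) nth 0%N (cd_t r j) l);
  cd_Q : 'M[F]_(\sum_(r < cd_m) \sum_(j < (cd_c r).+1)
                  \sum_(l < size (cd_t r j)) nth 0%N (cd_t r j) l, n);
  cd_spectrum : forall u : F,
    eigenvalue A u <-> exists r, in_chain (cd_lam r) (cd_c r) u;
  cd_disjoint : forall r s u, r != s ->
    ~ (in_chain (cd_lam r) (cd_c r) u /\ in_chain (cd_lam s) (cd_c s) u);
  cd_separated : forall r s u v, r != s ->
    in_chain (cd_lam r) (cd_c r) u -> in_chain (cd_lam s) (cd_c s) v ->
    u - v <> 1;
  cd_sizes : forall (r : 'I_cd_m) (j : nat), (j <= cd_c r)%N ->
    (0 < size (cd_t r j))%N /\ all (fun q => 0 < q)%N (cd_t r j);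
  cd_PQ : cd_P *m cd_Q = 1%:M;
  cd_QP : cd_Q *m cd_P = 1%:M;
  cd_similar : cd_Q *m A *m cd_P =
    \mxdiag_(r < cd_m) chain_jordan_mx (cd_lam r) (cd_c r) (cd_t r)
}.

(** ** Successive Sylvester equations for [diag(nu_0, I + nu_1, ...)] *)

Definition stair_mx (F : pzRingType) (k : nat) (s : 'I_k -> nat)
    (nu : forall j, 'M[F]_(s j)) : 'M[F]_(\sum_j s j) :=
  \mxdiag_(j < k) ((j%:R : F)%:M + nu j).

Definition sylvester_mx (F : pzRingType) (p q : nat) (B : 'M[F]_q)
    (C : 'M[F]_p) (x : 'M[F]_(p, q)) : 'M[F]_(p, q) :=
  x *m B - C *m x.

(* [1/d Id - 1/d^2 v + 1/d^3 v^2 - ...] applied to [psi], for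
   [v y = y b - a y].  If [a] and [b] are nilpotent then [v ^ (p + q) = 0], so
   the sum stops at [p + q]. *)
Definition neumann_mx (F : numFieldType) (p q : nat) (a : 'M[F]_p)
    (b : 'M[F]_q) (d : nat) (psi : 'M[F]_(p, q)) : 'M[F]_(p, q) :=
  \sum_(0 <= l < p + q)
    ((-1) ^+ l / d%:R ^+ l.+1) *: iter l (sylvester_mx b a) psi.

Definition psi_mx (F : numFieldType) (n k : nat) (s : 'I_k -> nat)
    (M : 'M[F]_(\sum_j s j)) (j j' : 'I_k) : 'M[F]_(s j, s j') :=
  submxblock (higher_terms n M) j j'.

Definition blocks_below (F : pzRingType) (k : nat) (s : 'I_k -> nat) (i : nat)
    (M : 'M[F]_(\sum_j s j)) : 'M[F]_(\sum_j s j) :=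
  \mxblock_(j < k, j' < k)
    (if (j < j' < j + i)%N then submxblock M j j' else 0).

Definition sylvester_system (F : numFieldType) (n k : nat) (s : 'I_k -> nat)
    (nu : forall j, 'M[F]_(s j)) (N : 'M[F]_(\sum_j s j)) : Prop :=
  [/\ forall j j' : 'I_k, (j' <= j)%N -> submxblock N j j' = 0,
      forall j j' : 'I_k, j' = (j + 1)%N :> nat ->
        sylvester_mx (nu j') (nu j) (submxblock N j j') = 0
    & forall (i : nat) (j j' : 'I_k), (2 <= i)%N -> j' = (j + i)%N :> nat ->
        sylvester_mx (((i - 1)%:R : F)%:M + nu j') (nu j) (submxblock N j j')
        = psi_mx n (blocks_below i N) j j'].

(* The seeds are the blocks [x1 j (j + 1)]; the other values of [x1] are
   irrelevant. *)
Definition valid_seeds (F : pzRingType) (k : nat) (s : 'I_k -> nat)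
    (nu : forall j, 'M[F]_(s j)) (x1 : forall j j' : 'I_k, 'M[F]_(s j, s j')) :
    Prop :=
  forall j j' : 'I_k, j' = (j + 1)%N :> nat ->
    sylvester_mx (nu j') (nu j) (x1 j j') = 0.

(* The block matrix obtained after computing the block diagonals [1, ..., i]:
   diagonal 1 consists of the seeds, and diagonal [d.+1], for [d >= 1], is
   computed from the diagonals [1, ..., d]. *)
Fixpoint successive_mx (F : numFieldType) (n k : nat) (s : 'I_k -> nat)
    (nu : forall j, 'M[F]_(s j)) (x1 : forall j j' : 'I_k, 'M[F]_(s j, s j'))
    (i : nat) : 'M[F]_(\sum_j s j) :=
  match i with
  | 0 => 0
  | d.+1 =>
      let M := successive_mx n nu x1 d in
      M + \mxblock_(j < k, j' < k)
            (if j' == (j + d.+1)%N :> nat then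
               if d == 0%N then x1 j j'
               else neumann_mx (nu j) (nu j') d (psi_mx n M j j')
             else 0)
  end.

(* Main.v *)
Require Import Defs.
From HB Require Import structures.
From mathcomp Require Import all_boot all_order all_algebra.
From mathcomp Require Import complex.
From mathcomp Require Import all_classical all_reals all_analysis.
Import Order.TTheory GRing.Theory Num.Theory numFieldNormedType.Exports.
From mathcomp Require Import ring zify.

(** Let [U = X A - A X = log X].  Then [U] commutes with [X = exp U], so by
    Jacobson's lemma ([nilpotent_commutator]) the commutator [U] of [X] and [A]
    is nilpotent.  Hence the exponential series of [U] is a polynomial in [U],
    [X = I + N] with [N] nilpotent, and [U = log (I + N)] is the truncated
    logarithmic series.  This step and its converse rest on the two identities
    [log_poly n o (exp_poly n - 1) = X] and [exp_poly n o log_poly n = 1 + X]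
    modulo [X^n] ([log_poly_exp_poly], [exp_poly_log_poly]).

    The equation [N A - A N = log (I + N)] is linearized by a change of
    variable.  There is a power series [g = X + O(X^2)] such that
    [g' log (1 + X) = g], and [Z = g(N)] then satisfies [Z A - A Z = Z], while
    [N] is a polynomial without constant term in [Z] ([linearized_solution]).
    When [A] is block diagonal with blocks [a + nilpotent], the block of [Z]
    from [a] to [b] is a solution of a homogeneous Sylvester equation whose
    operator is [b - a - 1] plus a nilpotent operator; so it is zero unless
    [b = a + 1] ([eigen_mxblock]).  Therefore the blocks of [Z], hence those of
    [N], vanish between different chains of eigenvalues
    ([chain_solution_diag]), and inside a chain they are strictly upper
    triangular ([nil_solution_above]).

    For a strictly upper triangular block matrix [N], the terms [N ^+ l] with
    [2 <= l] contribute to the [i]-th block diagonal through the previous block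
    diagonals only ([higher_terms_block]).  The equation is thus equivalent to
    the successive Sylvester equations ([nil_solution_sylvester]).  Each of
    them, beyond the first block diagonal, has the operator [(i - 1) Id + nu]
    with [nu] nilpotent, which is inverted by a finite Neumann series
    ([sylvester_neumann]).

    The decomposition of [A] is obtained from its spectral idempotents, which
    are polynomials in [A] given by Bezout identities
    ([spectral_idempotents]), from the Jordan form of a nilpotent matrix, built
    by splitting off cyclic summands ([nilpotent_jordan]), and from the
    partition of the spectrum into maximal chains ([chain_splitting]). *)

Set Implicit Arguments.
Unset Strict Implicit.
Unset Printing Implicit Defensive.

Local Open Scope ring_scope.

(** * Truncated power series *)

Lemma dvdp_XnP (F : fieldType) n (p : {poly F}) :
  reflect (forall i, (i < n)%N -> p`_i = 0) ('X^n %| p).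
Proof.
apply: (iffP idP) => [/dvdpP[q ->] i lt_in|p0]; first by rewrite coefMXn lt_in.
rewrite -[p](poly_take_drop n) (_ : take_poly n p = 0) ?add0r ?dvdp_mull //.
apply/polyP => i; rewrite coef_take_poly coef0.
by case: ifP => // /p0.
Qed.

Section TruncatedSeries.
Variable F : numFieldType.
Implicit Types (p q r g l : {poly F}) (n k : nat).

Lemma dvdp_comp_sub p q r : q - r %| (p \Po q) - (p \Po r).
Proof.
elim/poly_ind: p => [|p c IHp]; first by rewrite !comp_poly0 subrr dvdp0.
rewrite !comp_polyD !comp_polyM !comp_polyX !comp_polyC.
rewrite [X in _ %| X](_ : _ = ((p \Po q) - (p \Po r)) * q + (p \Po r) * (q - r)).
  by apply: dvdp_add; [rewrite dvdp_mulr | rewrite dvdp_mull].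
by ring.
Qed.

(** Congruences modulo [X^n] are preserved by the substitution of a series
    without constant term. *)
Lemma dvdp_Xn_comp n p q : 'X %| q -> 'X^n %| p -> 'X^n %| p \Po q.
Proof.
move=> Xq /(dvdp_comp_poly q); apply: dvdp_trans.
by rewrite comp_Xn_poly dvdp_exp2r.
Qed.

Lemma dvdp_Xn_antideriv n p : p`_0 = 0 -> 'X^n %| p^`() -> 'X^(n.+1) %| p.
Proof.
move=> p0 /dvdp_XnP dp0; apply/dvdp_XnP => -[//|i] lt_in.
have /eqP := dp0 i lt_in; rewrite coef_deriv -mulr_natr mulf_eq0 pnatr_eq0 orbF.
by move/eqP.
Qed.

Lemma dvdp_X_sub g : 'X^2 %| g - 'X -> 'X %| g.
Proof.
move=> gX; rewrite -[g](subrK 'X) dvdp_add //.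
by apply: dvdp_trans gX; rewrite expr2 dvdp_mulIl.
Qed.

(** Compositional inversion of a power series [g = X + O(X^2)] modulo [X^n]. *)
Lemma comp_left_inverse n g : 'X^2 %| g - 'X ->
  exists h, 'X^n %| (h \Po g) - 'X.
Proof.
move=> gX; elim: n => [|n [h hg]]; first by exists 0; rewrite dvd1p.
have /dvdpP[u def_u] := hg.
(* the coefficient of degree [n] of the error is cancelled by [g ^+ n] *)
exists (h - u`_0 *: 'X^n).
have gXn : 'X^(n.+1) %| g ^+ n - 'X^n.
  case: n {u def_u h hg} => [|n]; first by rewrite subrr dvdp0.
  rewrite subrXX (_ : 'X^(n.+2) = 'X^2 * 'X^n); last by rewrite -exprD.
  apply: dvdp_mul => //; apply: (big_ind (fun p => 'X^n %| p)) => [|p q|i _].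
  - exact: dvdp0.
  - exact: dvdp_add.
  have le_in : (i <= n)%N by rewrite -ltnS.
  rewrite /= -[n in X in X %| _](subnK le_in) exprD dvdp_mul //.
  by rewrite dvdp_exp2r // dvdp_X_sub.
rewrite comp_polyB comp_polyZ comp_Xn_poly.
rewrite [X in _ %| X](_ : _ = (u - (u`_0)%:P) * 'X^n - u`_0 *: (g ^+ n - 'X^n));
  last first.
  by rewrite scalerBr mulrBl -def_u mul_polyC; ring.
rewrite dvdp_sub ?dvdp_scaler //; last by rewrite -mul_polyC dvdp_mull.
rewrite exprS dvdp_mul //.
by apply/(dvdp_XnP 1) => -[|//] _; rewrite coefB coefC subrr.
Qed.

(** A formal eigenfunction [g], for the eigenvalue 1, of the derivation
    [l d/dX], where [l = X + O(X^2)]. *)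
Lemma flow_eigenfunction n l : 'X^2 %| l - 'X ->
  exists2 g, 'X^2 %| g - 'X & 'X^n %| g^`() * l - g.
Proof.
move=> lX; elim: n => [|n [g gX gl]].
  by exists 'X; rewrite ?subrr ?dvdp0 ?dvd1p.
have [lt_n2|le_2n] := ltnP n 2.
  exists 'X; first by rewrite subrr dvdp0.
  by rewrite derivX mul1r; apply: dvdp_trans lX; rewrite dvdp_exp2l.
case: n le_2n gl => [|[|k]] // _ gl.
have /dvdpP[u def_u] := gl.
(* the correction [c X^n] of [g] changes the error by [c (n - 1) X^n] *)
set c := u`_0 / (k.+1)%:R; exists (g - c *: 'X^(k.+2)).
  rewrite addrAC dvdp_sub // -mul_polyC dvdp_mull //.
  by rewrite dvdp_exp2l.
have cE : c%:P * (k.+1)%:R = (u`_0)%:P :> {poly F}.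
  by rewrite -polyC_natr -polyCM /c divfK // pnatr_eq0.
rewrite [X in _ %| X](_ : _ = (u - (u`_0)%:P) * 'X^(k.+2)
    - c%:P * 'X^(k.+1) * (l - 'X) * (k.+2)%:R).
  apply: dvdp_sub.
    rewrite exprS dvdp_mul //.
    by apply/(dvdp_XnP 1) => -[|//] _; rewrite coefB coefC subrr.
  rewrite dvdp_mulr // -mulrA dvdp_mull //.
  rewrite (_ : 'X^(k.+3) = 'X^(k.+1) * 'X^2); last by rewrite -exprD addn2.
  by rewrite dvdp_mul.
rewrite derivB derivZ derivXn /= [(u - _) * _]mulrBl -def_u -cE -!mul_polyC.
rewrite -mulr_natr (exprS _ k.+1) -[k.+2]addn1 natrD; ring.
Qed.

(** The series of [ln (1 + X)] and of [exp X], without their terms of degree [n]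
    and more. *)
Definition log_poly n : {poly F} := \sum_(1 <= i < n) ((-1) ^+ (i - 1) / i%:R) *: 'X^i.
Definition exp_poly n : {poly F} := \sum_(0 <= k < n) (k`!%:R)^-1 *: 'X^k.

Lemma log_poly0 n : (log_poly n)`_0 = 0.
Proof.
rewrite coef_sum big_nat big1 // => i /andP[i_gt0 _].
by rewrite coefZ coefXn eq_sym -leqn0 leqNgt i_gt0 mulr0.
Qed.

Lemma exp_poly0 n : (exp_poly n.+1)`_0 = 1.
Proof.
rewrite coef_sum big_nat_recl //= big1 => [|i _]; last first.
  by rewrite coefZ coefXn mulr0.
by rewrite coefZ coefXn fact0 invr1 mulr1 addr0.
Qed.

Lemma log_poly_sub n : 'X^2 %| log_poly n.+2 - 'X.
Proof.
rewrite /log_poly big_nat_recl // expr0 divr1 scale1r addrAC subrr add0r.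
rewrite big_nat; apply: (big_ind (fun p => 'X^2 %| p)) => [|p q|i /andP[i_gt0 _]].
- exact: dvdp0.
- exact: dvdp_add.
by rewrite -mul_polyC dvdp_mull // dvdp_exp2l.
Qed.

Lemma exp_poly_sub n : 'X^2 %| exp_poly n.+2 - 1 - 'X.
Proof.
rewrite /exp_poly big_nat_recl // big_nat_recl //= !fact0 invr1 !scale1r.
have -> (a : {poly F}) : 'X^0 + ('X^1 + a) - 1 - 'X = a by ring.
apply: (big_ind (fun p => 'X^2 %| p)) => [|p q|i _].
- exact: dvdp0.
- exact: dvdp_add.
by rewrite -mul_polyC dvdp_mull // dvdp_exp2l.
Qed.

Lemma deriv_log_poly n : (1 + 'X) * (log_poly n.+1)^`() = 1 - (- 'X) ^+ n.
Proof.
rewrite -[RHS]opprB subrX1 -mulNr opprB opprK; congr (_ * _).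
rewrite /log_poly raddf_sum big_add1 -(big_mkord xpredT (fun i => (- 'X) ^+ i)).
apply: eq_bigr => i _.
rewrite /= derivZ derivXn subn1 /= -(scaler_nat i.+1 'X^i) scalerA divfK ?pnatr_eq0 //.
by rewrite (exprNn 'X) -signr_odd scaler_sign -[in RHS]signr_odd mulr_sign.
Qed.

Lemma deriv_exp_poly n : (exp_poly n.+1)^`() = exp_poly n.
Proof.
rewrite /exp_poly raddf_sum big_nat_recl //= derivZ derivXn scaler0 add0r.
apply: eq_bigr => i _; rewrite /= derivZ derivXn /= -(scaler_nat i.+1 'X^i) scalerA factS.
by rewrite natrM invfM mulrAC mulVf ?mul1r // pnatr_eq0.
Qed.

Lemma log_poly_exp_poly n : (2 <= n)%N -> 'X^n %| (log_poly n \Po (exp_poly n - 1)) - 'X.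
Proof.
case: n => [|[|n]] // _; set e := _ - 1.
have Xe : 'X %| e by rewrite dvdp_X_sub // exp_poly_sub.
have e0 : e`_0 = 0 by move/(dvdp_XnP 1): Xe; apply.
apply: dvdp_Xn_antideriv.
  rewrite coefB coefX subr0 -horner_coef0 horner_comp [e.[0]]horner_coef0 e0.
  by rewrite horner_coef0 log_poly0.
rewrite derivB derivX deriv_comp.
have -> : e^`() = 1 + e - ((n.+1)`!%:R^-1 *: 'X^(n.+1)).
  have -> : 1 + e = exp_poly n.+2 by rewrite /e addrC subrK.
  rewrite /e derivB -polyC1 derivC subr0 deriv_exp_poly.
  by rewrite [exp_poly n.+2]/exp_poly big_nat_recr //= addrK.
have le1 : 'X^(n.+1) %| (1 + e) * ((log_poly n.+2)^`() \Po e) - 1.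
  have := congr1 (fun p => p \Po e) (deriv_log_poly n.+1).
  rewrite comp_polyM !comp_polyD comp_polyX -polyC1 !comp_polyC => ->.
  rewrite addrAC subrr add0r; apply: dvdp_Xn_comp => //.
  by rewrite dvdpNr exprNn dvdp_mull.
rewrite mulrBr addrAC mulrC dvdp_sub //.
by rewrite -mul_polyC !dvdp_mull.
Qed.

(** The inverse series is unique: [log_poly n] has a left inverse [h] for the
    composition, which is then congruent to its right inverse [exp_poly n - 1]. *)
Lemma exp_poly_log_poly n : (2 <= n)%N -> 'X^n %| (exp_poly n \Po log_poly n) - (1 + 'X).
Proof.
case: n => [|[|n]] // _; have le := log_poly_exp_poly (isT : (2 <= n.+2)%N).
set e := exp_poly n.+2 - 1 in le *; set l := log_poly n.+2 in le *.
have Xl : 'X %| l by rewrite dvdp_X_sub // log_poly_sub.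
have Xe : 'X %| e by rewrite dvdp_X_sub // exp_poly_sub.
have [h hl] := comp_left_inverse n.+2 (log_poly_sub n).
(* [h = h o (l o e) = (h o l) o e = e] modulo [X^n] *)
have he : 'X^(n.+2) %| h - e.
  rewrite (_ : h - e = (((h \Po l) - 'X) \Po e) - ((h \Po (l \Po e)) - h)).
    rewrite dvdp_sub ?dvdp_Xn_comp //.
    by apply: dvdp_trans le _; have := dvdp_comp_sub h (l \Po e) 'X; rewrite comp_polyXr.
  by rewrite comp_polyB comp_polyX comp_polyA; ring.
rewrite (_ : _ - _ = ((h \Po l) - 'X) - ((h - e) \Po l)).
  by rewrite dvdp_sub ?dvdp_Xn_comp.
by rewrite /e !comp_polyB -polyC1 comp_polyC; ring.
Qed.

End TruncatedSeries.

(** * Polynomials in a matrix and commutators *)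

Section PolynomialsInAMatrix.
Variables (F : fieldType) (n : nat).
Implicit Types (p q : {poly F}) (A B N L U X : 'M[F]_n.+1).

Lemma horner_mx_comp N p q : horner_mx N (p \Po q) = horner_mx (horner_mx N q) p.
Proof.
elim/poly_ind: p => [|p c IHp]; first by rewrite comp_poly0 !rmorph0.
rewrite comp_polyD comp_polyM comp_polyX comp_polyC.
by rewrite !rmorphD !rmorphM /= IHp !horner_mx_C horner_mx_X.
Qed.

(** The commutator with [A] is a derivation. *)
Lemma commutator_horner N A L p :
  N * A - A * N = L -> N * L = L * N ->
  horner_mx N p * A - A * horner_mx N p = horner_mx N p^`() * L.
Proof.
move=> defL NL; elim/poly_ind: p => [|p c IHp].
  by rewrite deriv0 !rmorph0 !mul0r mulr0 subrr.
have cL : horner_mx N p * L = L * horner_mx N p by apply: comm_horner_mx.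
rewrite derivD derivM derivX derivC addr0 mulr1 !rmorphD !rmorphM /=.
rewrite horner_mx_C horner_mx_X.
rewrite [_ * A]mulrDl [A * _]mulrDr -(scalar_mxC c A : A * c%:M = c%:M * A).
rewrite opprD addrACA subrr addr0 [RHS]mulrDl.
transitivity (horner_mx N p * (N * A - A * N)
              + (horner_mx N p * A - A * horner_mx N p) * N).
  by rewrite mulrBr mulrBl !mulrA addrA subrK.
by rewrite defL IHp -!mulrA NL addrC.
Qed.

(** The minimal polynomial of a nilpotent matrix is a power of [X], of degree at
    most the size of the matrix. *)
Lemma expr_nilpotent_mx N : nilpotent_mx N -> N ^+ n.+1 = 0.
Proof.
case=> k Nk0; have: mxminpoly N %| ('X - 0%:P) ^+ k.
  by apply: mxminpoly_min; rewrite subr0 rmorphXn /= horner_mx_X.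
case/dvdp_exp_XsubCP => j _; rewrite subr0 => minN.
have le_jn : (j <= n.+1)%N.
  rewrite -ltnS -[j.+1](size_polyXn F) -(eqp_size minN) -(size_char_poly N).
  by rewrite dvdp_leq ?mxminpoly_dvd_char // monic_neq0 ?char_poly_monic.
have Nj0 : N ^+ j = 0.
  have : mxminpoly N %| 'X^j by rewrite (eqp_dvdl _ minN).
  by move/mxminpoly_minP; rewrite rmorphXn /= horner_mx_X.
have -> : N ^+ n.+1 = N ^+ (n.+1 - j) * N ^+ j by rewrite -exprD subnK.
by rewrite Nj0 mulr0.
Qed.

Lemma horner_mx_eqmod N p q : nilpotent_mx N -> 'X^(n.+1) %| p - q ->
  horner_mx N p = horner_mx N q.
Proof.
move=> nilN /dvdpP[u def_u]; apply/eqP; rewrite -subr_eq0 -rmorphB def_u.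
by rewrite rmorphM rmorphXn /= horner_mx_X expr_nilpotent_mx // mulr0.
Qed.

Lemma nilpotent_horner N p : nilpotent_mx N -> p`_0 = 0 ->
  nilpotent_mx (horner_mx N p).
Proof.
move=> [k Nk0] p0; exists k.
have /dvdpP[q ->] : 'X^1 %| p by apply/(dvdp_XnP 1) => -[].
rewrite rmorphM /= horner_mx_X exprMn_comm ?Nk0 ?mulr0 //.
by apply/commr_sym/comm_mx_horner.
Qed.

End PolynomialsInAMatrix.

(** Jacobson's lemma.  If [p] is the characteristic polynomial of [X], then
    the commutator with [A] turns [p^(k)(X) U^m = 0] into
    [p^(k+1)(X) U^(2 m + 1) = 0], and the derivative of order [deg p] of [p] is
    a nonzero constant. *)
Lemma nilpotent_commutator (F : numFieldType) n (A X U : 'M[F]_n.+1) :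
  X * A - A * X = U -> X * U = U * X -> nilpotent_mx U.
Proof.
move=> defU XU; set p := char_poly X.
have step k : exists m, horner_mx X p^`(k) * U ^+ m = 0.
  elim: k => [|k [m IHk]].
    by exists 0; rewrite derivn0 Cayley_Hamilton mul0r.
  set P := horner_mx X p^`(k) in IHk.
  have PU j : P * U ^+ j = U ^+ j * P.
    by apply/commrX/(comm_horner_mx (B := U)).
  (* [U ^+ m * (P * A - A * P) * U ^+ m] vanishes term by term *)
  have UmP : U ^+ m * P = 0 by rewrite -PU.
  exists (m + m.+1)%N.
  have dP := commutator_horner p^`(k) defU XU; rewrite -derivnS -/P in dP.
  have cP' : GRing.comm (horner_mx X p^`(k.+1)) (U ^+ m).
    by apply/commrX/(comm_horner_mx (B := U)).
  rewrite exprD mulrA cP' -mulrA exprS [_ * (U * _)]mulrA -dP mulrBl mulrBr.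
  by rewrite -[A * P * _]mulrA IHk !mulr0 subr0 !mulrA UmP !mul0r.
have [m] := step n.+1.
have -> : p^`(n.+1) = (n.+1)`!%:R%:P.
  have size_p : size p = n.+2 := size_char_poly X.
  apply/polyP => i; rewrite coef_derivn coefC; case: i => [|i] /=.
    have := monicP (char_poly_monic X); rewrite -/p lead_coefE size_p addn0 => ->.
    by rewrite ffactnn.
  by rewrite nth_default ?mul0rn // size_p addnS ltnS leq_addr.
rewrite horner_mx_C -mulmxE mul_scalar_mx => /eqP; rewrite scaler_eq0 pnatr_eq0 -leqn0.
by rewrite leqNgt fact_gt0 => /eqP Um0; exists m.
Qed.

Section NilpotentSeries.
Variable F : numFieldType.

Lemma horner_log_poly n q (N : 'M[F]_q.+1) : (2 <= n)%N ->
  horner_mx N (log_poly F n) = N + higher_terms n N.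
Proof.
case: n => [|[|n]] // _; rewrite /log_poly big_nat_recl // subnn expr0 divr1 scale1r.
rewrite rmorphD /= horner_mx_X; congr (_ + _); rewrite /higher_terms.
rewrite rmorph_sum /= [RHS]big_add1; apply: eq_bigr => i _.
by rewrite linearZ /= rmorphXn /= horner_mx_X.
Qed.

Lemma horner_exp_poly n q (N : 'M[F]_q.+1) :
  horner_mx N (exp_poly F n) = \sum_(0 <= k < n) (k`!%:R)^-1 *: N ^+ k.
Proof.
rewrite /exp_poly rmorph_sum /=; apply: eq_bigr => i _.
by rewrite linearZ /= rmorphXn /= horner_mx_X.
Qed.

Lemma nilpotent_expr_le n q (N : 'M[F]_q) :
  nilpotent_mx N -> (q <= n)%N -> N ^+ n = 0.
Proof.
case: q N => [|q] N nilN le_qn; first by rewrite [LHS]flatmx0 [RHS]flatmx0.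
by rewrite -(subnK le_qn) exprD expr_nilpotent_mx // mulr0.
Qed.

(** Linearization: with [g' log(1 + X) = g], the matrix [Z = g(N)] satisfies
    [Z A - A Z = Z], and [N] is a polynomial without constant term in [Z]. *)
Lemma linearized_solution n q (A N : 'M[F]_q) :
  (2 <= n)%N -> (q <= n)%N -> nil_solution n A N ->
  exists Z : 'M[F]_q, exists d (c : nat -> F),
    Z *m A - A *m Z = Z /\ N = \sum_(1 <= i < d) c i *: Z ^+ i.
Proof.
(* matrices of size 0, which do not form a nonzero ring, are treated apart *)
case: q A N => [|q] A N n_ge2 le_qn [nilN solN].
  exists 0, 0%N, (fun=> 0); split; first by rewrite mul0mx mulmx0 subr0.
  by rewrite [LHS]flatmx0 [RHS]flatmx0.
rewrite -horner_log_poly // in solN.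
have lX : 'X^2 %| log_poly F n - 'X.
  by case: n n_ge2 {le_qn solN} => [|[|n]] // _; apply: log_poly_sub.
have [g gX gl] := flow_eigenfunction n lX.
have [h hg] := comp_left_inverse n gX.
have XnE (p r : {poly F}) : 'X^n %| p - r -> horner_mx N p = horner_mx N r.
  by move=> dv; apply: horner_mx_eqmod => //; apply: dvdp_trans dv; rewrite dvdp_exp2l.
exists (horner_mx N g), (size h), (fun i => h`_i); split.
  rewrite (commutator_horner g solN); last first.
    by rewrite -{1 4}[N]horner_mx_X; apply: comm_horner_mx2.
  by rewrite -rmorphM; apply: XnE.
have g0 : g`_0 = 0 by have /(dvdp_XnP 1) := dvdp_X_sub gX; apply.
have h0 : h`_0 = 0.
  have := dvdp_trans (dvdp_exp2l 'X (ltnW n_ge2)) hg.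
  move/(dvdp_XnP 1)/(_ 0%N isT); rewrite coefB coefX subr0 -horner_coef0.
  by rewrite horner_comp horner_coef0 g0 horner_coef0.
rewrite -{1}[N]horner_mx_X -(XnE _ _ hg) horner_mx_comp -{1}[h]coefK poly_def.
rewrite rmorph_sum /= -(big_mkord xpredT (fun i => horner_mx _ (h`_i *: 'X^i))).
case: (size h) => [|s]; first by rewrite !big_geq.
rewrite big_nat_recl // h0 scale0r rmorph0 add0r [RHS]big_add1.
by apply: eq_bigr => i _; rewrite linearZ /= rmorphXn /= horner_mx_X.
Qed.

End NilpotentSeries.

(** * The exponential of a matrix *)

Section MatrixConvergence.
Local Open Scope classical_set_scope.

Lemma cvg_mx_coord (T : topologicalType) m n (u : nat -> 'M[T]_(m, n))
    (M : 'M[T]_(m, n)) :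
  u k @[k --> \oo] --> M -> forall i j, u k i j @[k --> \oo] --> M i j.
Proof.
move=> uM i j P MP.
have := uM [set B : 'M[T]_(m, n) | P (B i j)].
apply; exists (fun i' j' => if (i', j') == (i, j) then P else setT).
  by move=> i' j'; case: ifPn => [/eqP[-> ->]//|_]; exact: filterT.
by move=> B /(_ i j); rewrite eqxx.
Qed.

Lemma cvg_sumr (K : numFieldType) (I : Type) (s : seq I) (f : nat -> I -> K)
    (a : I -> K) :
  (forall i, f k i @[k --> \oo] --> a i) ->
  \sum_(i <- s) f k i @[k --> \oo] --> \sum_(i <- s) a i.
Proof.
move=> fa; elim: s => [|i s IHs].
  rewrite big_nil; under eq_fun do rewrite big_nil.
  exact: cvg_cst.
rewrite big_cons; under eq_fun do rewrite big_cons.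
by apply: cvgD.
Qed.

Lemma cvg_mx_comm (K : numFieldType) n (U M : 'M[K]_n) (u : nat -> 'M[K]_n) :
  (forall k, U *m u k = u k *m U) -> u k @[k --> \oo] --> M ->
  U *m M = M *m U.
Proof.
move=> uU uM; have cu i j : u k i j @[k --> \oo] --> M i j by apply: cvg_mx_coord.
apply/matrixP => i j.
have h1 : (U *m u k) i j @[k --> \oo] --> (U *m M) i j.
  rewrite mxE; under eq_fun do rewrite mxE.
  by apply: cvg_sumr => k; apply: cvgMr; exact: cu.
have h2 : (U *m u k) i j @[k --> \oo] --> (M *m U) i j.
  under eq_fun do rewrite uU mxE.
  by rewrite mxE; apply: cvg_sumr => k; apply: cvgMl; exact: cu.
exact: (cvg_unique _ h1 h2).
Qed.

End MatrixConvergence.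

Section MatrixExponential.
Local Open Scope classical_set_scope.
Variable R : realType.

(** The partial sums of the series are eventually constant. *)
Lemma expmx_nilpotent n (U : 'M[R[i]]_n) d : U ^+ d = 0 ->
  expmx U = \sum_(0 <= k < d) (k`!%:R)^-1 *: U ^+ k.
Proof.
move=> Ud0; rewrite /expmx;
pose V : normedModType R[i] := 'M[R[i]]_n.
apply: (@cvg_lim V _ _ _ _ _ (\sum_(0 <= k < d) (k`!%:R)^-1 *: U ^+ k)).
  exact: norm_hausdorff.
apply: cvg_near_cst; exists d => // k /= le_dk.
rewrite /series /= (big_cat_nat (leq0n d) le_dk) //= [X in _ + X]big_nat.
rewrite [X in _ + X]big1 ?addr0 //.
by move=> j /andP[le_dj _]; rewrite -(subnK le_dj) exprD Ud0 mulr0 scaler0.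
Qed.

(** This holds whether or not the series converges: the limit of a divergent
    sequence is 0 by convention. *)
Lemma expmx_comm n (U : 'M[R[i]]_n) : U *m expmx U = expmx U *m U.
Proof.
set u := series (fun k : nat => (k`!%:R)^-1 *: U ^+ k).
have uU k : U *m u k = u k *m U.
  rewrite /u /series /= mulmx_sumr mulmx_suml; apply: eq_bigr => j _.
  by rewrite -scalemxAl -scalemxAr; congr (_ *: _); rewrite -[LHS]exprS -[RHS]exprSr.
have [cvgu|] := pselect (cvg (u @ \oo)); last first.
  move=> ncvg; rewrite /expmx -/u (dvgP ncvg).
  rewrite (_ : point = 0) ?mulmx0 ?mul0mx //.
  by apply/matrixP => i j; rewrite !mxE.
exact: (cvg_mx_comm uU cvgu).
Qed.

End MatrixExponential.

(** * Solutions of the logarithmic equation *)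

Lemma eigenvalue_nilpotent (F : fieldType) n (U : 'M[F]_n) a :
  nilpotent_mx U -> eigenvalue U a -> a = 0.
Proof.
move=> [k Uk0] /eigenvalueP[v vU v_neq0]; apply/eqP.
have vUj j : v *m U ^+ j = a ^+ j *: v.
  elim: j => [|j IHj]; first by rewrite !expr0 scale1r [1]/(1%:M) mulmx1.
  by rewrite exprSr [_ * U]/(_ *m U) mulmxA IHj -scalemxAl vU scalerA -exprSr.
have := vUj k; rewrite Uk0 mulmx0 => /esym/eqP.
by rewrite scaler_eq0 (negPf v_neq0) orbF expf_eq0 => /andP[].
Qed.

(** For the converse, [X = 1 + N] has the only eigenvalue 1 and its logarithm the
    only eigenvalue 0. *)
Lemma log_equation (R : realType) n (A X : 'M[R[i]]_n) : (2 <= n)%N ->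
  (no_eigenvalue_Rminus X /\ is_logmx X (X *m A - A *m X)) <->
  exists N : 'M[R[i]]_n,
    [/\ X = 1%:M + N, nilpotent_mx N
      & N *m A - A *m N = N + higher_terms n N].
Proof.
case: n A X => [//|n] A X n_ge2; split.
  set U := X *m A - A *m X; move=> [_ [expU _]].
  have nilU : nilpotent_mx U.
    (* [U] commutes with [X = exp U] *)
    apply: (@nilpotent_commutator _ _ A X) => //.
    by rewrite -[X in X * U]expU -[X in U * X]expU -!mulmxE expmx_comm.
  have Xexp : X = horner_mx U (exp_poly R[i] n.+1).
    by rewrite -expU (expmx_nilpotent (expr_nilpotent_mx nilU)) horner_exp_poly.
  exists (X - 1%:M); split; first by rewrite addrC subrK.
    have -> : X - 1%:M = horner_mx U (exp_poly R[i] n.+1 - 1).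
      by rewrite rmorphB /= -Xexp (rmorph1 (horner_mx U)).
    apply: nilpotent_horner => //.
    by rewrite coefB coefC exp_poly0 subrr.
  have -> : (X - 1%:M) *m A - A *m (X - 1%:M) = U.
    by rewrite mulmxBl mulmxBr mul1mx mulmx1 opprB addrA subrK.
  rewrite -horner_log_poly // Xexp -[1%:M](rmorph1 (horner_mx U)) -rmorphB.
  rewrite -horner_mx_comp (horner_mx_eqmod (q := 'X)) ?horner_mx_X //.
  exact: log_poly_exp_poly.
move=> [N [-> nilN solN]].
have -> : (1%:M + N) *m A - A *m (1%:M + N) = N *m A - A *m N.
  by rewrite mulmxDl mulmxDr mul1mx mulmx1 opprD addrACA subrr add0r.
rewrite -horner_log_poly // in solN.
split.
  move=> x x_le0; apply/negP => eigx.
  have /(eigenvalue_nilpotent nilN) : eigenvalue N (x%:C%C - 1).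
    have /eigenvalueP[v vX v_neq0] := eigx; apply/eigenvalueP; exists v => //.
    by rewrite scalerBl -vX mulmxDr mulmx1 scale1r addrAC subrr add0r.
  move/eqP; rewrite subr_eq0 => /eqP /(congr1 (@complex.Re R)) /= x1.
  by move: x_le0; rewrite x1 ler10.
have nilL : nilpotent_mx (horner_mx N (log_poly R[i] n.+1)).
  by apply: nilpotent_horner => //; apply: log_poly0.
rewrite solN; split; last first.
  move=> z /(eigenvalue_nilpotent nilL) -> /=.
  by rewrite oppr_lt0 pi_gt0.
rewrite (expmx_nilpotent (expr_nilpotent_mx nilL)) -horner_exp_poly -horner_mx_comp.
rewrite (horner_mx_eqmod (q := 1 + 'X)) //; last exact: exp_poly_log_poly.
by rewrite rmorphD rmorph1 /= horner_mx_X.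
Qed.

(** * Sylvester equations with nilpotent coefficients *)

Section SylvesterLinear.
Variables (F : comPzRingType) (p q : nat) (a : 'M[F]_p) (b : 'M[F]_q).
Implicit Types x : 'M[F]_(p, q).

Lemma sylvester_mxB x y :
  sylvester_mx b a (x - y) = sylvester_mx b a x - sylvester_mx b a y.
Proof. by rewrite /sylvester_mx mulmxBl mulmxBr !opprD !opprK addrACA. Qed.

Lemma sylvester_mxZ c x : sylvester_mx b a (c *: x) = c *: sylvester_mx b a x.
Proof. by rewrite /sylvester_mx -scalemxAl -scalemxAr scalerBr. Qed.

Lemma sylvester_mx_sum (r : seq nat) (f : nat -> 'M[F]_(p, q)) :
  sylvester_mx b a (\sum_(l <- r) f l) = \sum_(l <- r) sylvester_mx b a (f l).
Proof. by rewrite /sylvester_mx mulmx_suml mulmx_sumr -sumrB. Qed.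

Lemma sylvester_mx_shift d x :
  sylvester_mx (d%:M + b) a x = d *: x + sylvester_mx b a x.
Proof. by rewrite /sylvester_mx mulmxDr mul_mx_scalar addrA. Qed.

End SylvesterLinear.

Section Sylvester.
Variables (F : numFieldType) (p q : nat) (a : 'M[F]_p) (b : 'M[F]_q).
Hypotheses (nil_a : nilpotent_mx a) (nil_b : nilpotent_mx b).
Implicit Types x psi : 'M[F]_(p, q).

(** The Sylvester operator of two nilpotent matrices is nilpotent, because
    [a ^+ i *m x *m b ^+ j] vanishes as soon as [p + q <= i + j]. *)
Lemma iter_sylvester_eq0 x : iter (p + q) (sylvester_mx b a) x = 0.
Proof.
suff H m i j : (p + q <= i + j + m)%N ->
    a ^+ i *m iter m (sylvester_mx b a) x *m b ^+ j = 0.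
  by have := H (p + q)%N 0%N 0%N (leqnn _); rewrite !expr0 mul1mx mulmx1.
elim: m i j => [|m IHm] i j le_pq /=.
  have [le_pi|lt_ip] := leqP p i.
    by rewrite (nilpotent_expr_le nil_a le_pi) !mul0mx.
  have le_qj : (q <= j)%N by lia.
  by rewrite (nilpotent_expr_le nil_b le_qj) mulmx0.
set y := iter m _ x in IHm *; rewrite /sylvester_mx mulmxBr mulmxBl !mulmxA.
have aS : a ^+ i *m a = a ^+ i.+1 by rewrite exprSr.
have bS : b *m b ^+ j = b ^+ j.+1 by rewrite exprS.
by rewrite aS -[a ^+ i *m y *m b *m _]mulmxA bS !IHm ?subrr //; lia.
Qed.

(** [d Id + v] is injective when [d] is nonzero and [v] nilpotent: on the kernel,
    the powers of [v] act as those of [- d]. *)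
Lemma sylvester_inj d x : d != 0 -> sylvester_mx (d%:M + b) a x = 0 -> x = 0.
Proof.
move=> d_neq0; rewrite sylvester_mx_shift addrC => /eqP; rewrite addr_eq0 => /eqP vx.
have iter_v m : iter m (sylvester_mx b a) x = (- d) ^+ m *: x.
  elim: m => [|m IHm]; first by rewrite expr0 scale1r.
  by rewrite iterS IHm sylvester_mxZ vx -scaleNr scalerA -exprSr.
apply/eqP; have := iter_v (p + q)%N; rewrite iter_sylvester_eq0 => /esym/eqP.
by rewrite scaler_eq0 expf_eq0 oppr_eq0 (negPf d_neq0) andbF.
Qed.

Lemma sylvester_neumann (d : nat) psi x : (0 < d)%N ->
  sylvester_mx ((d%:R : F)%:M + b) a x = psi <-> x = neumann_mx a b d psi.
Proof.
move=> d_gt0; have d_neq0 : d%:R != 0 :> F by rewrite pnatr_eq0 -lt0n.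
have solN : sylvester_mx ((d%:R : F)%:M + b) a (neumann_mx a b d psi) = psi.
  (* the image of the Neumann sum is a telescoping sum *)
  pose t l := ((-1) ^+ l / d%:R ^+ l) *: iter l (sylvester_mx b a) psi.
  rewrite sylvester_mx_shift /neumann_mx scaler_sumr sylvester_mx_sum -big_split /=.
  transitivity (\sum_(0 <= l < p + q) (t l - t l.+1)); last first.
    rewrite (@telescope_sumr_eq _ _ _ (fun l => - t l)) // => [|l _].
      by rewrite /t iter_sylvester_eq0 scaler0 oppr0 add0r opprK divr1 scale1r.
    by rewrite opprK addrC.
  apply: eq_bigr => l _; rewrite sylvester_mxZ scalerA /t; congr (_ + _).
    by congr (_ *: _); rewrite exprS; field; rewrite d_neq0 expf_neq0.
  by rewrite iterS -scaleNr; congr (_ *: _); rewrite [in RHS]exprS mulN1r mulNr opprK.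
split=> [defpsi|-> //].
apply/eqP; rewrite -subr_eq0; apply/eqP/(sylvester_inj d_neq0).
by rewrite sylvester_mxB solN defpsi subrr.
Qed.

End Sylvester.

(** * Block diagonals and the equation for one chain *)

Section Blocks.
Variable F : pzRingType.

Lemma submxblock_mul k l m (p : 'I_k -> nat) (q : 'I_l -> nat) (r : 'I_m -> nat)
    (M : 'M[F]_(\sum_i p i, \sum_i q i)) (N : 'M[F]_(\sum_i q i, \sum_i r i)) i j :
  submxblock (M *m N) i j = \sum_h submxblock M i h *m submxblock N h j.
Proof. by rewrite -{1}[M]submxblockK -{1}[N]submxblockK mul_mxblock mxblockK. Qed.

Lemma submxblock_mul_diag k l (p : 'I_k -> nat) (q : 'I_l -> nat)
    (M : 'M[F]_(\sum_i p i, \sum_i q i)) (B : forall j, 'M[F]_(q j)) i j :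
  submxblock (M *m \mxdiag_j B j) i j = submxblock M i j *m B j.
Proof. by rewrite -{1}[M]submxblockK mul_mxblock_mxdiag mxblockK. Qed.

Lemma submxblock_diag_mul k l (p : 'I_k -> nat) (q : 'I_l -> nat)
    (M : 'M[F]_(\sum_i p i, \sum_i q i)) (B : forall i, 'M[F]_(p i)) i j :
  submxblock (\mxdiag_i B i *m M) i j = B i *m submxblock M i j.
Proof. by rewrite -{1}[M]submxblockK mul_mxdiag_mxblock mxblockK. Qed.

Lemma submxblockZ (c : F) k l (p : 'I_k -> nat) (q : 'I_l -> nat)
    (M : 'M[F]_(\sum_i p i, \sum_i q i)) i j :
  submxblock (c *: M) i j = c *: submxblock M i j.
Proof. by apply/matrixP => u v; rewrite !mxE. Qed.

End Blocks.

(** The block from the eigenvalue [a] to the eigenvalue [b] of a matrix that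
    increases the generalized eigenvalues by 1 vanishes unless [b = a + 1]. *)
Lemma eigen_block (F : numFieldType) p q (a b : F) (nu : 'M[F]_p) (nu' : 'M[F]_q)
    (x : 'M[F]_(p, q)) :
  nilpotent_mx nu -> nilpotent_mx nu' -> b - a != 1 ->
  x *m (b%:M + nu') - (a%:M + nu) *m x = x -> x = 0.
Proof.
move=> nil_nu nil_nu' ba eqx; apply: (sylvester_inj nil_nu nil_nu' (d := b - a - 1)).
  by rewrite subr_eq0.
rewrite sylvester_mx_shift !scalerBl scale1r -{3}eqx /sylvester_mx.
apply/eqP; rewrite addrAC subr_eq0 mulmxDr mulmxDl mul_mx_scalar mul_scalar_mx.
by rewrite opprD addrACA.
Qed.

Lemma eigen_mxblock (F : numFieldType) k l (p : 'I_k -> nat) (q : 'I_l -> nat)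
    (a : 'I_k -> F) (b : 'I_l -> F) (nu : forall i, 'M[F]_(p i))
    (nu' : forall j, 'M[F]_(q j)) (X : 'M[F]_(\sum_i p i, \sum_j q j)) i j :
  (forall i, nilpotent_mx (nu i)) -> (forall j, nilpotent_mx (nu' j)) ->
  X *m \mxdiag_j ((b j)%:M + nu' j) - \mxdiag_i ((a i)%:M + nu i) *m X = X ->
  b j - a i != 1 -> submxblock X i j = 0.
Proof.
move=> nil_nu nil_nu' eqX neq1; apply: (eigen_block (nil_nu i) (nil_nu' j) neq1).
rewrite -[in RHS]eqX submxblockB.
by rewrite submxblock_mul_diag submxblock_diag_mul.
Qed.

(** Block matrices supported on the block diagonals [d], [d + 1], ... *)
Definition above_diag (F : pzRingType) k (s : 'I_k -> nat) (d : nat)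
    (M : 'M[F]_(\sum_j s j)) : Prop :=
  forall j j' : 'I_k, (j' < j + d)%N -> submxblock M j j' = 0.

Section AboveDiagonal.
Variables (F : pzRingType) (k : nat) (s : 'I_k -> nat).
Implicit Types (M N : 'M[F]_(\sum_j s j)) (d e : nat).

Lemma above_diagW d e M : (d <= e)%N -> above_diag e M -> above_diag d M.
Proof. by move=> le_de Me j j' lt_jj'; apply: Me; lia. Qed.

Lemma above_diag_mul d e M N :
  above_diag d M -> above_diag e N -> above_diag (d + e) (M *m N).
Proof.
move=> Md Ne j j' lt_jj'; rewrite submxblock_mul big1 // => h _.
have [lt_h|le_h] := ltnP h (j + d); first by rewrite Md ?mul0mx.
by rewrite Ne ?mulmx0 //; lia.
Qed.

Lemma above_diagD d M N : above_diag d M -> above_diag d N -> above_diag d (M + N).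
Proof. by move=> Md Nd j j' lt_jj'; rewrite submxblockD Md ?Nd ?addr0. Qed.

Lemma above_diag_comb d (r : seq nat) (P : pred nat) (c : nat -> F)
    (f : nat -> 'M[F]_(\sum_j s j)) :
  (forall i, P i -> above_diag d (f i)) ->
  above_diag d (\sum_(i <- r | P i) c i *: f i).
Proof.
move=> fd; apply: (big_ind (@above_diag F k s d)) => [j j' _|M N|i Pi j j' lt_jj'].
- exact: submxblock0.
- exact: above_diagD.
by rewrite submxblockZ fd ?scaler0.
Qed.

(** The powers of a strictly upper triangular block matrix move away from the
    diagonal. *)
Lemma above_diagX M i : above_diag 1 M -> above_diag i (M ^+ i).
Proof.
move=> M1; elim: i => [|i IHi].
  rewrite expr0 => j j'; rewrite addn0 => lt_j'j.
  rewrite [1](_ : _ = \mxdiag_j (1%:M : 'M[F]_(s j))); last by rewrite mxdiagZ.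
  have neq_jj' : j != j' by apply: contraTneq lt_j'j => ->; rewrite ltnn.
  by rewrite /mxdiag mxblockK (negPf neq_jj').
by rewrite exprS -add1n; apply: above_diag_mul.
Qed.

Lemma above_diag_nilpotent M : above_diag 1 M -> nilpotent_mx M.
Proof.
move=> M1; exists k; rewrite -[LHS]submxblockK -[0]submxblockK.
apply: eq_mxblock => j j'; rewrite submxblock0 (above_diagX M1) //.
by have := ltn_ord j'; lia.
Qed.

Lemma blocks_belowE i M j j' :
  submxblock (blocks_below i M) j j' =
  if (j < j' < j + i)%N then submxblock M j j' else 0.
Proof. by rewrite mxblockK. Qed.

Lemma above_diag_below i M : above_diag 1 (blocks_below i M).
Proof. by move=> j j' lt_jj'; rewrite blocks_belowE ifF //; lia. Qed.

Lemma above_diag_below_sub i M :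
  above_diag 1 M -> above_diag i (M - blocks_below i M).
Proof.
move=> M1 j j' lt_jj'; rewrite submxblockB blocks_belowE.
case: ifPn => [|lt]; first by rewrite subrr.
by rewrite subr0 M1 //; lia.
Qed.

(** If a strictly upper triangular [M] is truncated to its block diagonals of
    index less than [i], the power [M ^+ l.+1] is unchanged on the block diagonals
    of index less than [i + l]. *)
Lemma above_diag_exp_sub i M l : above_diag 1 M ->
  above_diag (i + l) (M ^+ l.+1 - blocks_below i M ^+ l.+1).
Proof.
move=> M1; elim: l => [|l IHl].
  by rewrite !expr1 addn0; apply: above_diag_below_sub.
have -> : M ^+ l.+2 - blocks_below i M ^+ l.+2 =
    M ^+ l.+1 *m (M - blocks_below i M)
    + (M ^+ l.+1 - blocks_below i M ^+ l.+1) *m blocks_below i M.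
  by rewrite mulmxBr mulmxBl addrA subrK !exprSr.
apply: above_diagD.
  rewrite [X in above_diag X](_ : _ = l.+1 + i)%N; last lia.
  by apply: above_diag_mul; [apply: above_diagX | apply: above_diag_below_sub].
rewrite [X in above_diag X](_ : _ = (i + l) + 1)%N; last lia.
by apply: above_diag_mul => //; apply: above_diag_below.
Qed.

End AboveDiagonal.

Section Stair.
Variables (F : numFieldType) (n k : nat) (s : 'I_k -> nat).
Variable nu : forall j, 'M[F]_(s j).
Hypotheses (n_ge2 : (2 <= n)%N) (le_sn : (\sum_j s j <= n)%N).
Hypothesis nil_nu : forall j, nilpotent_mx (nu j).
Implicit Types N : 'M[F]_(\sum_j s j).

Lemma higher_terms_above N : above_diag 1 N -> above_diag 2 (higher_terms n N).
Proof.
move=> N1; rewrite /higher_terms big_nat_cond; apply: above_diag_comb => i.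
rewrite andbT => /andP[i_ge2 _].
exact: above_diagW i_ge2 (above_diagX N1).
Qed.

Lemma higher_terms_block N i (j j' : 'I_k) : above_diag 1 N ->
  j' = (j + i)%N :> nat ->
  submxblock (higher_terms n N) j j' = psi_mx n (blocks_below i N) j j'.
Proof.
move=> N1 def_j'; apply/eqP; rewrite -subr_eq0 -submxblockB; apply/eqP.
have : above_diag i.+1 (\sum_(2 <= l < n) ((-1) ^+ (l - 1) / l%:R) *:
                         (N ^+ l - blocks_below i N ^+ l)).
  rewrite big_nat_cond; apply: above_diag_comb => l.
  rewrite andbT => /andP[l_ge2 _]; case: l l_ge2 => [|l] // l_ge2.
  by apply: (above_diagW _ (above_diag_exp_sub N1)); lia.
have -> : \sum_(2 <= l < n) ((-1) ^+ (l - 1) / l%:R) *: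
      (N ^+ l - blocks_below i N ^+ l) =
    higher_terms n N - higher_terms n (blocks_below i N).
  by rewrite -sumrB; apply: eq_bigr => l _; rewrite scalerBr.
by apply; rewrite def_j' addnS.
Qed.

(** The eigenvalues of the diagonal blocks are 0, 1, 2, ... in this order, so the
    linearized solution vanishes on and below the block diagonal, and so does [N],
    a polynomial without constant term in it. *)
Lemma nil_solution_above N : nil_solution n (stair_mx nu) N -> above_diag 1 N.
Proof.
move=> solN; have [Z [d [c [eqZ ->]]]] := linearized_solution n_ge2 le_sn solN.
have Z1 : above_diag 1 Z.
  move=> j j' lt_jj';
  apply: (@eigen_mxblock _ _ _ _ _ (fun j => j%:R) (fun j => j%:R) _ _ _ _ _
    nil_nu nil_nu eqZ).
  rewrite subr_eq nat1r eqr_nat; lia.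
rewrite big_nat_cond; apply: above_diag_comb => i; rewrite andbT => /andP[i_gt0 _].
exact: above_diagW i_gt0 (above_diagX Z1).
Qed.

Lemma nil_solution_sylvester N :
  nil_solution n (stair_mx nu) N <-> sylvester_system n nu N.
Proof.
(* the block diagonal [i] of the commutator *)
have block_eq (j j' : 'I_k) i : j' = (j + i)%N :> nat ->
    submxblock (N *m stair_mx nu - stair_mx nu *m N) j j' =
    submxblock N j j' +
    sylvester_mx (((i%:R : F) - 1)%:M + nu j') (nu j) (submxblock N j j').
  move=> def_j'; rewrite submxblockB submxblock_mul_diag submxblock_diag_mul.
  rewrite def_j' natrD sylvester_mx_shift scalerBl scale1r /sylvester_mx.
  rewrite [in RHS]addrA [in X in _ = X + _]addrC subrK.
  rewrite mulmxDr mulmxDl mul_mx_scalar mul_scalar_mx scalerDl opprD addrACA.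
  by rewrite [X in X - _ + _]addrC addrK.
split=> [solN|[N0 N1eq Nieq]].
  have N1 := nil_solution_above solN; have [_ eqN] := solN.
  have block_sol (j j' : 'I_k) i : j' = (j + i)%N :> nat ->
      sylvester_mx (((i%:R : F) - 1)%:M + nu j') (nu j) (submxblock N j j') =
      submxblock (higher_terms n N) j j'.
    move=> def_j'; apply: (addrI (submxblock N j j')).
    by rewrite -block_eq // eqN submxblockD.
  split=> [j j' le_j'j|j j' def_j'|i j j' i_ge2 def_j'].
  - by apply: N1; lia.
  - have := block_sol _ _ _ def_j'; rewrite subrr (raddf0 (@scalar_mx F _)) add0r => ->.
    by rewrite higher_terms_above ?def_j' //; lia.
  rewrite natrB; last lia.
  by rewrite (block_sol _ _ _ def_j') (higher_terms_block N1 def_j').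
have N1 : above_diag 1 N by move=> j j' lt_jj'; apply: N0; lia.
split; first exact: above_diag_nilpotent.
rewrite -[LHS]submxblockK -[RHS]submxblockK; apply: eq_mxblock => j j'.
have [le_j'j|lt_jj'] := leqP j' j.
  rewrite submxblockB submxblock_mul_diag submxblock_diag_mul.
  rewrite submxblockD higher_terms_above //; last lia.
  by rewrite N0 // mul0mx mulmx0 subrr addr0.
have [i def_j'] : exists i, j' = (j + i)%N :> nat.
  by exists (j' - j)%N; rewrite subnKC // ltnW.
rewrite [RHS]submxblockD (block_eq _ _ _ def_j'); congr (_ + _).
rewrite (higher_terms_block N1 def_j').
have [i_ge2|i_lt2] := leqP 2 i.
  by rewrite -(Nieq _ _ _ i_ge2 def_j') natrB //; lia.
have i1 : i = 1%N by lia.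
rewrite -(higher_terms_block N1 def_j') higher_terms_above //; last lia.
by rewrite i1 subrr (raddf0 (@scalar_mx F _)) add0r N1eq // def_j' i1.
Qed.

End Stair.

(** * Successive computation of the block diagonals *)

Section Successive.
Variables (F : numFieldType) (n k : nat) (s : 'I_k -> nat).
Variable nu : forall j, 'M[F]_(s j).
Hypothesis nil_nu : forall j, nilpotent_mx (nu j).
Implicit Types N : 'M[F]_(\sum_j s j).

(** The blocks of [successive_mx] in closed form: the block diagonal of index
    [j' - j] was filled from the matrix computed one step before. *)
Lemma successive_mx_block (x1 : forall j j' : 'I_k, 'M[F]_(s j, s j')) d
    (j j' : 'I_k) :
  submxblock (successive_mx n nu x1 d) j j' =
  if (j < j' <= j + d)%N then
    if (j' - j).-1 == 0%N then x1 j j'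
    else neumann_mx (nu j) (nu j') (j' - j).-1
           (psi_mx n (successive_mx n nu x1 (j' - j).-1) j j')
  else 0.
Proof.
elim: d => [|d IHd] /=; first by rewrite submxblock0 ifF //; lia.
rewrite submxblockD IHd mxblockK.
have [def_j'|neq] := eqVneq (j' : nat) (j + d.+1)%N.
  rewrite [X in X + _]ifF; last lia.
  have -> : (j' - j).-1 = d by rewrite def_j' addKn.
  by rewrite add0r [RHS]ifT //; lia.
rewrite addr0; suff -> : (j < j' <= j + d.+1)%N = (j < j' <= j + d)%N by [].
lia.
Qed.

Lemma blocks_below_successive (x1 : forall j j' : 'I_k, 'M[F]_(s j, s j')) d m :
  (d <= m)%N ->
  blocks_below d.+1 (successive_mx n nu x1 m) = successive_mx n nu x1 d.
Proof.
move=> le_dm; rewrite -[LHS]submxblockK -[RHS]submxblockK.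
apply: eq_mxblock => j j'; rewrite blocks_belowE !successive_mx_block addnS ltnS.
by case: ifPn => // /andP[-> le_j'] /=; rewrite ifT //; lia.
Qed.

Lemma sylvester_successive N :
  sylvester_system n nu N <->
  exists x1 : (forall j j' : 'I_k, 'M[F]_(s j, s j')),
    valid_seeds nu x1 /\ N = successive_mx n nu x1 (k - 1).
Proof.
split=> [[N0 N1eq Nieq]|[x1 [x1_valid ->]]].
  pose x1 j j' := submxblock N j j'; exists x1; split=> [j j'|]; first exact: N1eq.
  have succE d : successive_mx n nu x1 d = blocks_below d.+1 N.
    elim: d => [|d IHd] /=.
      rewrite -[LHS]submxblockK -[RHS]submxblockK; apply: eq_mxblock => j j'.
      by rewrite blocks_belowE submxblock0 ifF //; lia.
    rewrite IHd -[LHS]submxblockK -[RHS]submxblockK; apply: eq_mxblock => j j'.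
    rewrite submxblockD !blocks_belowE mxblockK.
    have [def_j'|neq] := eqVneq (j' : nat) (j + d.+1)%N; last first.
      by rewrite addr0 (_ : (_ < _ < j + d.+2)%N = (j < j' < j + d.+1)%N) //; lia.
    rewrite [X in X + _]ifF; last lia.
    rewrite add0r [RHS]ifT; last lia.
    case: eqP => [//|/eqP d_neq0].
    apply/esym/(sylvester_neumann (nil_nu j) (nil_nu j')); first by rewrite lt0n.
    by rewrite -(Nieq d.+1) ?subSS ?subn0 // ltnS lt0n.
  rewrite succE -[LHS]submxblockK -[RHS]submxblockK; apply: eq_mxblock => j j'.
  rewrite blocks_belowE; case: ifPn => // nle; apply: N0.
  by have := ltn_ord j'; lia.
split=> [j j' le_j'j|j j' def_j'|i j j' i_ge2 def_j'].
- by rewrite successive_mx_block ifF //; lia.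
- rewrite successive_mx_block ifT; last by have := ltn_ord j'; lia.
  by rewrite ifT ?x1_valid //; lia.
have lt_j'k := ltn_ord j'.
apply/(sylvester_neumann (nil_nu j) (nil_nu j')); first lia.
rewrite successive_mx_block ifT; last lia.
rewrite ifF; last lia.
have -> : (j' - j).-1 = (i - 1)%N by lia.
rewrite -[i in blocks_below i](subnK (ltnW i_ge2)) addn1.
by rewrite blocks_below_successive //; lia.
Qed.

Lemma nil_solution_successive N : (2 <= n)%N -> (\sum_j s j <= n)%N ->
  nil_solution n (stair_mx nu) N <->
  exists x1 : (forall j j' : 'I_k, 'M[F]_(s j, s j')),
    valid_seeds nu x1 /\ N = successive_mx n nu x1 (k - 1).
Proof.
move=> n_ge2 le_sn.
exact: iff_trans (nil_solution_sylvester n_ge2 le_sn nil_nu N) (sylvester_successive N).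
Qed.

End Successive.

(** * Jordan form of a nilpotent matrix *)

(** The columns of [P] are a basis of the image of the idempotent [E], the rows
    of [Q] are the dual coordinates, and [A] acts on this image by [B]. *)
Definition acts_as (F : pzRingType) n q (A E : 'M[F]_n) (B : 'M[F]_q)
    (P : 'M[F]_(n, q)) (Q : 'M[F]_(q, n)) : Prop :=
  [/\ Q *m P = 1%:M, P *m Q = E & A *m P = P *m B].

Section ActsAs.
Variable F : fieldType.

Lemma acts_as_trans n q r (A E : 'M[F]_n) (B : 'M[F]_q) (C : 'M[F]_r) P Q P' Q' :
  acts_as A E B P Q -> acts_as B 1%:M C P' Q' ->
  acts_as A E C (P *m P') (Q' *m Q).
Proof.
move=> [QP PQ AP] [QP' PQ' BP']; split.
- by rewrite mulmxA -[_ *m Q *m P]mulmxA QP mulmx1.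
- by rewrite mulmxA -[P *m P' *m Q']mulmxA PQ' mulmx1.
by rewrite mulmxA AP -mulmxA BP' mulmxA.
Qed.

Lemma acts_as_orth n q r (A E E' : 'M[F]_n) (B : 'M[F]_q) (B' : 'M[F]_r) P Q P' Q' :
  acts_as A E B P Q -> acts_as A E' B' P' Q' -> E *m E' = 0 -> Q *m P' = 0.
Proof.
move=> [QP PQ _] [QP' PQ' _] EE'.
rewrite -[Q]mul1mx -QP -[P']mulmx1 -QP' -[Q *m P *m Q]mulmxA PQ.
by rewrite [P' *m _]mulmxA PQ' !mulmxA -[Q *m E *m E']mulmxA EE' mulmx0 mul0mx.
Qed.

Lemma mxcol_mxrow_1 n m (p : 'I_m -> nat) (P : forall i, 'M[F]_(n, p i))
    (Q : forall i, 'M[F]_(p i, n)) :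
  (forall i, Q i *m P i = 1%:M) -> (forall i j, i != j -> Q i *m P j = 0) ->
  \mxcol_i Q i *m \mxrow_i P i = 1%:M.
Proof.
move=> QP1 QP0; rewrite mul_mxcol_mxrow -mxdiagZ /mxdiag.
apply: eq_mxblock => i j; case: eqP => [eq_ij|/eqP]; last exact: QP0.
by subst j; rewrite conform_mx_id.
Qed.

Lemma acts_as_sum n m (p : 'I_m -> nat) (A : 'M[F]_n) (E : 'I_m -> 'M[F]_n)
    (B : forall i, 'M[F]_(p i)) (P : forall i, 'M[F]_(n, p i))
    (Q : forall i, 'M[F]_(p i, n)) :
  (forall i, acts_as A (E i) (B i) (P i) (Q i)) ->
  (forall i j, i != j -> E i *m E j = 0) ->
  acts_as A (\sum_i E i) (\mxdiag_i B i) (\mxrow_i P i) (\mxcol_i Q i).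
Proof.
move=> actA orthE; split.
- apply: mxcol_mxrow_1 => [i|i j neq_ij]; first by case: (actA i).
  exact: acts_as_orth (actA i) (actA j) (orthE i j neq_ij).
- rewrite mul_mxrow_mxcol; apply: eq_bigr => i _; by case: (actA i).
rewrite mul_mxrow mul_mxrow_mxdiag; apply: eq_mxrow => i; by case: (actA i).
Qed.

(** A full rank factorization [E = P Q] of an idempotent satisfies [Q P = 1]. *)
Lemma acts_as_idempotent n (A E : 'M[F]_n) : E *m E = E -> A *m E = E *m A ->
  exists B : 'M[F]_(\rank E), exists P Q, acts_as A E B P Q.
Proof.
move=> EE AE.
have [P [Q [PQ fullP freeQ]]] : exists (P : 'M[F]_(n, \rank E)) (Q : 'M[F]_(\rank E, n)),
    [/\ P *m Q = E, row_full P & row_free Q].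
  exists (col_base E), (row_base E); split; first exact: mulmx_base.
    exact: col_base_full.
  exact: row_base_free.
have QP : Q *m P = 1%:M.
  have: P *m (Q *m P) *m Q = P *m 1%:M *m Q.
    by rewrite mulmx1 !mulmxA PQ -mulmxA PQ EE.
  by move/(row_free_inj freeQ)/(row_full_inj fullP).
exists (Q *m A *m P), P, Q; split=> //.
rewrite !mulmxA PQ -[P in LHS]mulmx1 -QP !mulmxA -[A *m P *m Q]mulmxA PQ AE.
by rewrite -[E *m A *m P]mulmxA.
Qed.

End ActsAs.

Section NilpotentJordan.
Variable F : fieldType.

(** A cyclic direct summand of maximal dimension: if [k] is the least integer
    such that [N ^+ k = 0] and the entry [(i0, j0)] of [N ^+ k.-1] is nonzero, the
    columns [N ^+ i e_j0] and the rows [e_i0 N ^+ i], for [i < k], are paired by an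
    invertible triangular matrix. *)
Lemma cyclic_summand d (N : 'M[F]_d) : (0 < d)%N -> nilpotent_mx N ->
  exists k, exists P : 'M[F]_(d, k), exists Q : 'M[F]_(k, d),
    [/\ (0 < k)%N, Q *m P = 1%:M, N *m P = P *m jordan_block 0 k
      & Q *m N = jordan_block 0 k *m Q].
Proof.
move=> d_gt0 nilN.
have ex_k : exists k, N ^+ k == 0 by have [k /eqP] := nilN; exists k.
case: (ex_minnP ex_k) => [[|k]] /eqP Nk0 min_k.
  have /matrixP/(_ (Ordinal d_gt0) (Ordinal d_gt0))/eqP := Nk0.
  by rewrite !mxE eqxx oner_eq0.
have Nk (i : nat) : (k < i)%N -> N ^+ i = 0.
  by move=> lt_ki; rewrite -(subnK lt_ki) exprD Nk0 mulr0.
have [i0 [j0 c_neq0]] : exists i0 j0, (N ^+ k) i0 j0 != 0.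
  have /matrix0Pn[i0 [j0 nz]] : N ^+ k != 0.
    by apply/negP => /min_k; rewrite ltnn.
  by exists i0, j0.
pose P : 'M[F]_(d, k.+1) := \matrix_(i, j) (N ^+ (k - j)) i j0.
pose Q : 'M[F]_(k.+1, d) := \matrix_(i, j) (N ^+ i) i0 j.
pose J : 'M[F]_k.+1 := jordan_block 0 k.+1.
have JE i j : J i j = (i.+1 == j :> nat)%:R by rewrite mxE mul0rn add0r.
have NP : N *m P = P *m J.
  apply/matrixP => i j; rewrite !mxE.
  transitivity ((N ^+ (k - j).+1) i j0).
    by rewrite exprS mxE; apply: eq_bigr => h _; rewrite mxE.
  case: (posnP j) => [j_0|j_gt0].
    rewrite Nk ?j_0 ?subn0 // mxE big1 // => h _.
    by rewrite JE j_0 mulr0.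
  have lt_j1 : (j.-1 < k.+1)%N by rewrite (leq_ltn_trans (leq_pred j)).
  rewrite (bigD1 (Ordinal lt_j1)) //= JE /= prednK // eqxx mulr1 big1 ?addr0.
    by rewrite mxE /=; congr ((N ^+ _) _ _); have := ltn_ord j; lia.
  move=> h neq_h; rewrite JE; case: eqP => [def_j|]; last by rewrite mulr0.
  by case/eqP: neq_h; apply: val_inj; rewrite /= -def_j.
have QN : Q *m N = J *m Q.
  apply/matrixP => i j; rewrite !mxE.
  transitivity ((N ^+ i.+1) i0 j).
    by rewrite exprSr mxE; apply: eq_bigr => h _; rewrite mxE.
  have [lt_ik|le_ki] := ltnP i.+1 k.+1.
    rewrite (bigD1 (Ordinal lt_ik)) //= JE /= eqxx mul1r big1 ?addr0 ?mxE //.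
    move=> h neq_h; rewrite JE; case: eqP => [def_h|]; last by rewrite mul0r.
    by case/eqP: neq_h; apply: val_inj; rewrite /= def_h.
  rewrite Nk // mxE big1 // => h _; rewrite JE.
  by case: eqP => [def_h|_]; [have := ltn_ord h; lia | rewrite mul0r].
pose H := Q *m P.
(* [H] is upper triangular with the diagonal entries [(N ^+ k) i0 j0] *)
have HE i j : H i j = (N ^+ (i + (k - j))) i0 j0.
  by rewrite exprD !mxE; apply: eq_bigr => h _; rewrite !mxE.
have unitH : H \in unitmx.
  rewrite -unitmx_tr unitmxE det_trig.
    apply/unitr_prodP => i _; rewrite mxE HE subnKC ?unitfE //.
    by rewrite -ltnS.
  apply/is_trig_mxP => i j lt_ij; rewrite mxE HE Nk ?mxE //.
  by have := ltn_ord i; have := ltn_ord j; lia.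
have HJ : H *m J = J *m H by rewrite /H -mulmxA -NP mulmxA QN mulmxA.
exists k.+1, P, (invmx H *m Q); split=> //.
  by rewrite -mulmxA mulVmx.
rewrite -mulmxA QN !mulmxA; congr (_ *m Q).
apply: (can_inj (mulKmx unitH)); rewrite !mulmxA mulmxV // mul1mx HJ.
by rewrite -mulmxA mulmxV // mulmx1.
Qed.

(** Jordan form of a nilpotent matrix.  The blocks are indexed by all natural
    numbers; those of index at least [size t] have size 0. *)
Lemma nilpotent_jordan_family d (N : 'M[F]_d) : nilpotent_mx N ->
  exists (t : seq nat) (P : forall l : nat, 'M[F]_(d, nth 0%N t l))
      (Q : forall l : nat, 'M[F]_(nth 0%N t l, d)),
    [/\ all (fun q => 0 < q)%N t, forall l, Q l *m P l = 1%:M,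
        forall l l', l != l' -> Q l *m P l' = 0,
        \sum_(l < size t) P l *m Q l = 1%:M
      & forall l, N *m P l = P l *m jordan_block 0 (nth 0%N t l)].
Proof.
have [b] := ubnP d; elim: b d N => // b IHb d N lt_db nilN.
case: (posnP d) => [d0|d_gt0].
  subst d; exists [::], (fun l => 0), (fun l => 0); split=> //= [l|l l' _||l].
  - by apply/matrixP => -[i lti]; exfalso; move: lti; rewrite nth_nil.
  - by rewrite mulmx0.
  - by rewrite big_ord0 [RHS]flatmx0.
  by rewrite mulmx0 mul0mx.
have [k [P1 [Q1 [k_gt0 QP1 NP1 QN1]]]] := cyclic_summand d_gt0 nilN.
pose E1 := P1 *m Q1; pose E2 := 1%:M - E1.
have E11 : E1 *m E1 = E1 by rewrite /E1 mulmxA -[P1 *m Q1 *m P1]mulmxA QP1 mulmx1.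
have E12 : E1 *m E2 = 0 by rewrite mulmxBr mulmx1 E11 subrr.
have E21 : E2 *m E1 = 0 by rewrite mulmxBl mul1mx E11 subrr.
have E22 : E2 *m E2 = E2 by rewrite {2}/E2 mulmxBr mulmx1 E21 subr0.
have NE1 : N *m E1 = E1 *m N by rewrite /E1 mulmxA NP1 -!mulmxA QN1.
have NE2 : N *m E2 = E2 *m N by rewrite mulmxBr mulmxBl mulmx1 mul1mx NE1.
have act1 : acts_as N E1 (jordan_block 0 k) P1 Q1 by [].
have [B [P2 [Q2 act2]]] := acts_as_idempotent E22 NE2.
have [QP2 PQ2 NP2] := act2.
have Q1P2 := acts_as_orth act1 act2 E12.
have Q2P1 := acts_as_orth act2 act1 E21.
(* the complement is a proper summand, since [P1] is nonzero *)
have lt_rank : (\rank E2 < d)%N.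
  rewrite ltn_neqAle rank_leq_row andbT; apply/negP => /eqP full.
  have P1_0 : P1 = 0.
    have E2_unit : E2 \in unitmx by rewrite -row_full_unit /row_full full.
    apply: (can_inj (mulKmx E2_unit)); rewrite mulmx0.
    by rewrite -PQ2 -mulmxA Q2P1 mulmx0.
  have /matrixP/(_ (Ordinal k_gt0) (Ordinal k_gt0))/eqP := QP1.
  by rewrite P1_0 mulmx0 !mxE eqxx mulr1n eq_sym oner_eq0.
have NP2k m : N ^+ m *m P2 = P2 *m B ^+ m.
  elim: m => [|m IHm]; first by rewrite !expr0 [LHS]mul1mx [RHS]mulmx1.
  rewrite !exprS [N * _]/(N *m _) [B * _]/(B *m _).
  by rewrite -mulmxA IHm !mulmxA NP2.
have nilB : nilpotent_mx B.
  have [m Nm0] := nilN; exists m.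
  by rewrite -[LHS]mul1mx -QP2 -mulmxA -NP2k Nm0 mul0mx mulmx0.
have [|t [P [Q [t_gt0 QP QP0 PQ BP]]]] := IHb _ B _ nilB.
  exact: leq_trans lt_rank lt_db.
exists (k :: t).
exists (fun l => match l return 'M[F]_(d, nth 0%N (k :: t) l) with
                 | 0%N => P1 | l'.+1 => P2 *m P l' end).
exists (fun l => match l return 'M[F]_(nth 0%N (k :: t) l, d) with
                 | 0%N => Q1 | l'.+1 => Q l' *m Q2 end).
split=> [|[|l]|[|l] [|l'] // neq_ll'||[|l]] //=.
- by rewrite k_gt0.
- by rewrite mulmxA -[Q l *m Q2 *m P2]mulmxA QP2 mulmx1.
- by rewrite mulmxA Q1P2 mul0mx.
- by rewrite -mulmxA Q2P1 mulmx0.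
- by rewrite mulmxA -[Q l *m Q2 *m P2]mulmxA QP2 mulmx1 QP0.
- rewrite big_ord_recl /= -/E1.
  under eq_bigr => l _ do rewrite mulmxA -[P2 *m _ *m _]mulmxA.
  by rewrite -mulmx_suml -mulmx_sumr PQ mulmx1 PQ2 addrC subrK.
by rewrite mulmxA NP2 -mulmxA BP mulmxA.
Qed.

Lemma jordan_mx_shift (a : F) t : jordan_mx a t = a%:M + jordan_mx 0 t.
Proof.
rewrite /jordan_mx -mxdiagZ -mxdiagD; apply: eq_mxdiag => l.
by apply/matrixP => i j; rewrite !mxE mul0rn add0r.
Qed.

Lemma nilpotent_jordan d (N : 'M[F]_d) (a : F) : nilpotent_mx (N - a%:M) ->
  exists t, all (fun q => 0 < q)%N t /\
    exists P Q, acts_as N 1%:M (jordan_mx a t) P Q.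
Proof.
move=> /nilpotent_jordan_family[t [P [Q [t_gt0 QP QP0 PQ NP]]]].
exists t; split=> //; exists (\mxrow_(l < size t) P l), (\mxcol_(l < size t) Q l).
split; first by apply: mxcol_mxrow_1 => // l l' neq; apply: QP0.
  by rewrite mul_mxrow_mxcol.
rewrite -[N](subrK a%:M) mulmxDl jordan_mx_shift mulmxDr addrC.
rewrite mul_scalar_mx mul_mx_scalar; congr (_ + _).
by rewrite mul_mxrow mul_mxrow_mxdiag; apply: eq_mxrow => l; apply: NP.
Qed.

End NilpotentJordan.

(** * Spectral idempotents *)

Section PolynomialIdempotents.
Variables (F : fieldType) (I : eqType) (f : I -> {poly F}).
Implicit Types (rs : seq I).

Lemma coprimep_big_prod rs (P : pred I) p :
  (forall b, b \in rs -> P b -> coprimep p (f b)) ->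
  coprimep p (\prod_(b <- rs | P b) f b).
Proof.
move=> cop; rewrite big_seq_cond; elim/big_ind: _ => [|q r|b /andP[b_rs Pb]].
- exact: coprimep1.
- by rewrite coprimepMr => -> ->.
exact: cop.
Qed.

Lemma dvdp_big_prod rs p : uniq rs ->
  (forall a b, a \in rs -> b \in rs -> a != b -> coprimep (f a) (f b)) ->
  (forall b, b \in rs -> f b %| p) -> \prod_(b <- rs) f b %| p.
Proof.
elim: rs => [|a rs IHrs] /=; first by rewrite big_nil dvd1p.
move=> /andP[a_rs uniq_rs] cop fp; rewrite big_cons Gauss_dvdp.
  rewrite fp ?mem_head // IHrs // => [b c b_rs c_rs|b b_rs].
    by apply: cop; rewrite inE ?b_rs ?c_rs orbT.
  by rewrite fp // inE b_rs orbT.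
apply: coprimep_big_prod => b b_rs _; apply: cop; rewrite ?inE ?eqxx ?b_rs ?orbT //.
by apply: contraNneq a_rs => ->.
Qed.

(** Chinese remainders: [e a] is 1 modulo [f a] and 0 modulo the other factors,
    so the [e a] are orthogonal idempotents of sum 1 modulo the product. *)
Lemma bezout_idempotents rs : uniq rs ->
  (forall a b, a \in rs -> b \in rs -> a != b -> coprimep (f a) (f b)) ->
  exists e : I -> {poly F},
    [/\ forall a, a \in rs -> \prod_(b <- rs) f b %| f a * e a,
        forall a, a \in rs -> f a %| e a - 1,
        forall a b, a \in rs -> b \in rs -> a != b ->
          \prod_(b <- rs) f b %| e a * e b
      & \prod_(b <- rs) f b %| \sum_(a <- rs) e a - 1].
Proof.
move=> uniq_rs cop.
pose h a := \prod_(b <- rs | b != a) f b.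
have fh a : a \in rs -> f a * h a = \prod_(b <- rs) f b.
  by move=> a_rs; rewrite [RHS](bigD1_seq a).
have f_h a b : b \in rs -> b != a -> f b %| h a.
  by move=> b_rs neq_ba; rewrite /h -big_filter (bigD1_seq b) /= ?dvdp_mulIl //
    ?filter_uniq // mem_filter neq_ba.
have /choice[e eP] : forall a, exists p : {poly F}, a \in rs ->
    h a %| p /\ f a %| p - 1.
  move=> a.
  case: (boolP (a \in rs)) => [a_rs|_]; last by exists 0.
  have /Bezout_eq1_coprimepP[[u v] /= uv] : coprimep (f a) (h a).
    apply: coprimep_big_prod => b b_rs neq_ba.
    by apply: cop; rewrite // eq_sym.
  exists (v * h a) => _; rewrite dvdp_mull //; split=> //.
  by rewrite -uv opprD addrCA subrr addr0 dvdpNr dvdp_mull.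
have fe a b : b \in rs -> a \in rs -> b != a -> f b %| e a.
  by move=> b_rs a_rs neq; have [he _] := eP a a_rs; apply: dvdp_trans he; apply: f_h.
exists e; split=> [a a_rs|a a_rs|a b a_rs b_rs neq_ab|].
- by rewrite -(fh a a_rs) dvdp_mul //; case: (eP a a_rs).
- by case: (eP a a_rs).
- rewrite -(fh b b_rs) dvdp_mul //; last by case: (eP b b_rs).
  by apply: fe; rewrite // eq_sym.
apply: dvdp_big_prod => // b b_rs.
rewrite (bigD1_seq b) //= addrAC dvdp_add //; first by case: (eP b b_rs).
rewrite big_seq_cond; elim/big_ind: _ => [|p q|a /andP[a_rs neq_ab]].
- exact: dvdp0.
- exact: dvdp_add.
by apply: fe; rewrite // eq_sym.
Qed.

End PolynomialIdempotents.

Section SpectralIdempotents.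
Variables (F : closedFieldType) (n : nat) (A : 'M[F]_n.+1).

(** The exponent [n.+1], the size of [A], bounds all the multiplicities. *)
Lemma spectrum_seq : exists rs : seq F,
  [/\ uniq rs, forall a, (a \in rs) = eigenvalue A a
    & char_poly A %| \prod_(a <- rs) ('X - a%:P) ^+ n.+1].
Proof.
have [r def_r] := closed_field_poly_normal (char_poly A).
rewrite (monicP (char_poly_monic A)) scale1r in def_r.
exists (undup r); split=> [|a|]; first exact: undup_uniq.
  by rewrite mem_undup eigenvalue_root_char def_r root_prod_XsubC.
have size_r : size r = n.+1.
  by have := size_char_poly A; rewrite def_r size_prod_XsubC => -[].
rewrite def_r prodrXl -size_r.
have: {subset r <= undup r} by move=> a; rewrite mem_undup.
elim: (r) (undup r) => [|a s IHs] r' sub_r'.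
  by rewrite big_nil dvd1p.
rewrite big_cons exprS dvdp_mul //; last first.
  by apply: IHs => b b_s; apply: sub_r'; rewrite inE b_s orbT.
by rewrite dvdp_XsubCl root_prod_XsubC sub_r' ?mem_head.
Qed.

Lemma eigenvector_horner (v : 'rV[F]_n.+1) a p :
  v *m A = a *: v -> v *m horner_mx A p = p.[a] *: v.
Proof.
move=> vA; elim/poly_ind: p => [|p c IHp].
  by rewrite rmorph0 mulmx0 horner0 scale0r.
rewrite rmorphD rmorphM /= horner_mx_C horner_mx_X hornerMXaddC.
rewrite mulmxDr [_ * A]/(_ *m A) mulmxA IHp -scalemxAl vA scalerA.
by rewrite mul_mx_scalar scalerDl.
Qed.

(** The projections onto the generalized eigenspaces of [A] along each other. *)
Lemma spectral_idempotents : exists (rs : seq F) (E : F -> 'M[F]_n.+1),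
  [/\ uniq rs, forall a, (a \in rs) = eigenvalue A a,
      forall a b, a \in rs -> b \in rs -> a != b -> E a *m E b = 0,
      \sum_(a <- rs) E a = 1%:M
    & forall a, a \in rs -> [/\ E a *m E a = E a, A *m E a = E a *m A, E a != 0
        & (A - a%:M) ^+ n.+1 *m E a = 0]].
Proof.
have [rs [uniq_rs rsE charA]] := spectrum_seq.
pose f (a : F) := ('X - a%:P) ^+ n.+1.
have cop a b : a \in rs -> b \in rs -> a != b -> coprimep (f a) (f b).
  move=> _ _ neq_ab; apply/coprimep_expl/coprimep_expr/coprimep_XsubC2.
  by rewrite subr_eq0 eq_sym.
have [e [fe e1 ee sum_e]] := bezout_idempotents uniq_rs cop.
have horner0A p : \prod_(b <- rs) f b %| p -> horner_mx A p = 0.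
  move=> /(dvdp_trans charA)/dvdpP[q ->].
  by rewrite rmorphM /= Cayley_Hamilton mulr0.
exists rs, (fun a => horner_mx A (e a)); split=> //.
- move=> a b a_rs b_rs neq_ab; rewrite [LHS](_ : _ = horner_mx A (e a * e b)).
    exact/horner0A/ee.
  by rewrite rmorphM.
- apply/eqP; rewrite -subr_eq0 -[1%:M](rmorph1 (horner_mx A)) -rmorph_sum -rmorphB.
  by apply/eqP/horner0A.
move=> a a_rs; split.
- apply/eqP; rewrite -subr_eq0 [X in X - _](_ : _ = horner_mx A (e a * e a)) ?rmorphM //.
  rewrite -rmorphM -rmorphB; apply/eqP/horner0A.
  have /dvdpP[u def_u] := e1 a a_rs.
  rewrite -[X in _ - X]mulr1 -mulrBr def_u.
  rewrite (_ : e a * (u * f a) = u * (f a * e a)); last by ring.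
  by rewrite dvdp_mull // fe.
- exact/comm_mx_horner.
- (* an eigenvector for [a] is fixed by [E a], as [e a] takes the value 1 at [a] *)
  apply/negP => /eqP E0; have := a_rs; rewrite rsE => /eigenvalueP[v vA v_neq0].
  have /eqP := eigenvector_horner (e a) vA; rewrite E0 mulmx0 eq_sym scaler_eq0.
  rewrite (negPf v_neq0) orbF => /eqP ea0.
  have /dvdpP[u /(congr1 (horner^~ a))] := e1 a a_rs.
  rewrite /= hornerM horner_exp !hornerE ea0 subrr exprS mul0r mulr0 sub0r.
  by move/eqP; rewrite oppr_eq0 oner_eq0.
rewrite [LHS](_ : _ = horner_mx A (f a * e a)); first exact/horner0A/fe.
by rewrite rmorphM rmorphXn rmorphB /= horner_mx_X horner_mx_C.
Qed.

End SpectralIdempotents.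

(** * Existence of a chain decomposition *)

Section Chains.
Variable F : numFieldType.
Implicit Types (rs : seq F) (a u : F).

(** In characteristic 0 a finite set does not contain [a + i] for all [i]. *)
Lemma finite_run rs a : exists i : nat, a + i%:R \notin rs.
Proof.
pose s := [seq a + i%:R | i <- iota 0 (size rs).+1].
have uniq_s : uniq s.
  rewrite map_inj_uniq ?iota_uniq // => i j /addrI /eqP.
  by rewrite eqr_nat => /eqP.
have /allPn[_ /mapP[i _ ->] ai] : ~~ all (mem rs) s.
  apply/negP => /allP sub; have := uniq_leq_size uniq_s sub.
  by rewrite size_map size_iota ltnn.
by exists i.
Qed.

(** A finite set of scalars is the disjoint union of its maximal chains, indexed
    by their least elements: the [a] in the set such that [a - 1] is not. *)
Lemma chain_splitting rs : exists (m : nat) (lam : 'I_m -> F) (c : 'I_m -> nat),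
  [/\ forall u, u \in rs <-> exists r, in_chain (lam r) (c r) u,
      forall r s u, r != s ->
        ~ (in_chain (lam r) (c r) u /\ in_chain (lam s) (c s) u)
    & forall r s u v, r != s ->
        in_chain (lam r) (c r) u -> in_chain (lam s) (c s) v -> u - v <> 1].
Proof.
pose st := undup [seq a <- rs | a - 1 \notin rs].
have stP a : (a \in st) = (a \in rs) && (a - 1 \notin rs).
  by rewrite mem_undup mem_filter andbC.
have runP a : exists c : nat, a \in rs ->
    (forall i, (i <= c)%N -> a + i%:R \in rs) /\ a + c.+1%:R \notin rs.
  have [[|c] notin_c min_c] := ex_minnP (finite_run rs a).
    by exists 0%N => a_rs; rewrite addr0 a_rs in notin_c.
  exists c => _; split=> // i le_ic; apply: contraT => /min_c.
  by rewrite ltnNge le_ic.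
have [c cP] := choice runP.
exists (size st), (fun r => nth 0 st r), (fun r => c (nth 0 st r)).
have lamP (r : 'I_(size st)) : [/\ nth 0 st r \in rs & nth 0 st r - 1 \notin rs].
  by apply/andP; rewrite -stP; apply/mem_nth/ltn_ord.
have inP (r : 'I_(size st)) u : in_chain (nth 0 st r) (c (nth 0 st r)) u -> u \in rs.
  by case=> i le_ic ->; have [lam_rs _] := lamP r; have [+ _] := cP _ lam_rs; apply.
have disj (r s : 'I_(size st)) u : r != s ->
    ~ (in_chain (nth 0 st r) (c (nth 0 st r)) u /\
       in_chain (nth 0 st s) (c (nth 0 st s)) u).
  move=> neq_rs [[i le_i ->] [j le_j eq_ij]].
  wlog le_ij : r s i j le_i le_j eq_ij neq_rs / (i <= j)%N.
    move=> W; have [le_ij|/ltnW le_ji] := leqP i j; first exact: (W r s i j).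
    by apply: (W s r j i) => //; rewrite eq_sym.
  have eq_lam : nth 0 st r = nth 0 st s + (j - i)%:R.
    by apply: (addIr i%:R); rewrite eq_ij natrB // addrA addrNK.
  have [ij0|ij_gt0] := posnP (j - i)%N.
    case/eqP: neq_rs; apply/val_inj/eqP => /=.
    by rewrite -(nth_uniq 0 (ltn_ord r) (ltn_ord s) (undup_uniq _)) eq_lam ij0 addr0.
  have [_ /negP[]] := lamP r; rewrite eq_lam.
  rewrite -[(j - i)%N](prednK ij_gt0) -natr1 addrA addrK.
  have [s_rs _] := lamP s; have [+ _] := cP _ s_rs; apply.
  by lia.
split=> // [u|r s u v neq_rs u_r [j le_j def_v] uv].
  split=> [u_rs|[r /inP //]].
  have [k u_k min_k] : exists2 k : nat, u - k%:R \in st &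
      forall i, (i <= k)%N -> u - i%:R \in rs.
    (* the start of the chain of [u]: descend while staying in [rs] *)
    have ex_b : exists b, u - b%:R \notin rs.
      have [b] := finite_run (map -%R rs) (- u); exists b.
      by rewrite -(mem_map oppr_inj) opprB addrC.
    have [[|k] notin_k min_k] := ex_minnP ex_b.
      by rewrite subr0 u_rs in notin_k.
    have in_k i : (i <= k)%N -> u - i%:R \in rs.
      by move=> le_ik; apply: contraT => /min_k; rewrite ltnNge le_ik.
    exists k => //; rewrite stP in_k //=.
    by rewrite -addrA -opprD natr1.
  have lt_r : (index (u - k%:R)%R st < size st)%N by rewrite index_mem.
  exists (Ordinal lt_r); rewrite /= nth_index //; exists k; last by rewrite subrK.
  have /cP[_ notin_c] : u - k%:R \in rs by apply: min_k.
  rewrite leqNgt; apply/negP => lt_ck; case/negP: notin_c.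
  rewrite (_ : u - k%:R + _ = u - (k - (c (u - k%:R)%R).+1)%:R).
    by apply: min_k; lia.
  by rewrite natrB // opprB addrA addrAC addrC addrA.
have def_u : u = nth 0 st s + j.+1%:R.
  by rewrite -(subrK v u) uv def_v -natr1 addrCA addrC addrA addrC addrCA addrC.
have [lt_j|le_cj] := ltnP j (c (nth 0 st s)).
  by apply: (disj _ _ u neq_rs); split=> //; exists j.+1.
have jc : j = c (nth 0 st s) by apply/eqP; rewrite eqn_leq le_j.
have [/cP[_ /negP[]]] := lamP s; rewrite -jc -def_u; exact: inP u_r.
Qed.

End Chains.

Lemma acts_as_expr (F : fieldType) n q (A E : 'M[F]_n) (B : 'M[F]_q) P Q (a : F) k :
  acts_as A E B P Q -> (A - a%:M) ^+ k *m P = P *m (B - a%:M) ^+ k.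
Proof.
move=> [_ _ AP]; elim: k => [|k IHk]; first by rewrite !expr0 [LHS]mul1mx [RHS]mulmx1.
have AaP : (A - a%:M) *m P = P *m (B - a%:M).
  by rewrite mulmxBl mulmxBr AP mul_scalar_mx mul_mx_scalar.
have -> : (A - a%:M) ^+ k.+1 = (A - a%:M) *m (A - a%:M) ^+ k by rewrite exprS.
have -> : (B - a%:M) ^+ k.+1 = (B - a%:M) *m (B - a%:M) ^+ k by rewrite exprS.
by rewrite -mulmxA IHk !mulmxA AaP.
Qed.

(** Jordan form of [A] on the image of an idempotent [E] on which [A - a] is
    nilpotent. *)
Lemma jordan_on_idempotent (F : fieldType) n (A E : 'M[F]_n) (a : F) k :
  E *m E = E -> A *m E = E *m A -> E != 0 -> (A - a%:M) ^+ k *m E = 0 ->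
  exists t : seq nat, [/\ all (fun q => 0 < q)%N t, (0 < size t)%N
    & exists P Q, acts_as A E (jordan_mx a t) P Q].
Proof.
move=> EE AE E_neq0 nilA.
have [B [P [Q actB]]] := acts_as_idempotent EE AE.
have [QP PQ AP] := actB.
have nilB : nilpotent_mx (B - a%:M).
  exists k; rewrite -[LHS]mul1mx -QP -mulmxA -(acts_as_expr _ _ actB).
  have EP : P *m Q *m P = P by rewrite -mulmxA QP mulmx1.
  rewrite PQ in EP.
  by rewrite -[X in _ *m (_ *m X)]EP [_ *m (_ *m P)]mulmxA nilA mul0mx mulmx0.
have [t [t_gt0 [P' [Q' actJ]]]] := nilpotent_jordan nilB.
have actA := acts_as_trans actB actJ.
exists t; split=> //; last by exists (P *m P'), (Q' *m Q).
case: actA => _ E0 _; case: (posnP (size t)) => // size_t.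
case/eqP: E_neq0; rewrite -E0; apply/matrixP => i j.
rewrite mxE big1 ?mxE // => -[h lt_h] _.
exfalso; move: lt_h; rewrite big1 // => l _.
by have := ltn_ord l; rewrite [X in (_ < X)%N]size_t.
Qed.

Lemma acts_as_sum_ex (F : fieldType) n m (p : 'I_m -> nat) (A : 'M[F]_n)
    (E : 'I_m -> 'M[F]_n) (B : forall i, 'M[F]_(p i)) :
  (forall i, exists P Q, acts_as A (E i) (B i) P Q) ->
  (forall i j, i != j -> E i *m E j = 0) ->
  exists P Q, acts_as A (\sum_i E i) (\mxdiag_i B i) P Q.
Proof.
move=> actA orthE.
pose P i := projT1 (cid (actA i)); pose PP i := projT2 (cid (actA i)).
pose Q i := projT1 (cid (PP i)); pose QP i := projT2 (cid (PP i)).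
exists (\mxrow_i P i), (\mxcol_i Q i).
exact: acts_as_sum QP orthE.
Qed.

Section Decomposition.
Variables (F : numClosedFieldType) (n : nat).

Lemma chain_decomposition_exists (A : 'M[F]_n.+1) : inhabited (chain_decomposition A).
Proof.
have [rs [E [uniq_rs rsE orthE sumE idE]]] := spectral_idempotents A.
have [m [lam [c [chainP disj sep]]]] := chain_splitting rs.
have in_rs r (j : nat) : (j <= c r)%N -> lam r + j%:R \in rs.
  by move=> le_j; apply/chainP; exists r, j.
have /choice[t tP] : forall a, exists t : seq nat, a \in rs ->
    [/\ all (fun q => 0 < q)%N t, (0 < size t)%N
      & exists P Q, acts_as A (E a) (jordan_mx a t) P Q].
  move=> a; case: (boolP (a \in rs)) => [a_rs|_]; last by exists [::].
  have [EE AE E_neq0 nilA] := idE a a_rs.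
  by have [t tP] := jordan_on_idempotent EE AE E_neq0 nilA; exists t.
have in_rs' r (j : 'I_(c r).+1) : lam r + j%:R \in rs
  by apply: in_rs; rewrite -ltnS.
have act_chain r : exists P Q, acts_as A (\sum_(j < (c r).+1) E (lam r + j%:R))
    (chain_jordan_mx (lam r) (c r) (fun j => t (lam r + j%:R))) P Q.
  apply: acts_as_sum_ex => [j|i j neq_ij].
    by have [] := tP _ (in_rs' r j).
  apply: orthE; [exact: in_rs' | exact: in_rs' |].
  by rewrite (inj_eq (addrI _)) eqr_nat.
(* multiply on the left by [1 = \sum_a E a]: each [a] is in exactly one chain *)
have sum1 : \sum_r \sum_(j < (c r).+1) E (lam r + j%:R) = 1%:M.
  rewrite -[LHS]mul1mx -sumE mulmx_suml big_seq [RHS]big_seq.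
  apply: eq_bigr => a a_rs.
  have /chainP[r [j le_j def_a]] := a_rs; rewrite -ltnS in le_j.
  rewrite mulmx_sumr (bigD1 r) //= [X in _ + X]big1 => [|r' neq_r]; last first.
    rewrite mulmx_sumr big1 // => j' _; apply: orthE; [exact: a_rs | exact: in_rs' |].
    apply/eqP => def_a'; apply: (disj _ _ a neq_r); split.
      by exists j'; rewrite // -ltnS.
    by exists j.
  rewrite addr0 mulmx_sumr (bigD1 (Ordinal le_j)) //= big1 => [|j' neq_j].
    by rewrite addr0 -def_a; case: (idE a a_rs).
  apply: orthE; [exact: a_rs | exact: in_rs' |].
  rewrite def_a (inj_eq (addrI _)) eqr_nat eq_sym.
  exact: neq_j.
have orth_chain r r' : r != r' -> (\sum_(j < (c r).+1) E (lam r + j%:R)) *m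
    (\sum_(j < (c r').+1) E (lam r' + j%:R)) = 0.
  move=> neq_r; rewrite mulmx_suml big1 // => j _; rewrite mulmx_sumr big1 // => j' _.
  apply: orthE; [exact: in_rs' | exact: in_rs' |].
  apply/eqP => eq_a; apply: (disj _ _ (lam r + j%:R) neq_r); split.
    by exists j; rewrite // -ltnS.
  by exists j'; rewrite // -ltnS.
have [P [Q []]] := acts_as_sum_ex act_chain orth_chain.
rewrite sum1 => QP PQ1 AP.
constructor; refine (@Build_chain_decomposition _ _ A m lam c
  (fun r j => t (lam r + j%:R)) _ _ _ disj sep _ PQ1 QP _).
- by move=> u; rewrite -rsE; exact: chainP.
- by move=> r j le_j; have /tP[? ?] := in_rs r j le_j.
by rewrite -mulmxA AP mulmxA QP mul1mx.
Qed.

End Decomposition.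

(** * Reduction to the chains *)

Section Transport.
Variable F : numFieldType.

(** The equation is invariant under similarity. *)
Lemma nil_solution_conj m n q (A N : 'M[F]_n) (B : 'M[F]_q)
    (P : 'M[F]_(n, q)) (Q : 'M[F]_(q, n)) :
  P *m Q = 1%:M -> Q *m P = 1%:M -> Q *m A *m P = B ->
  nil_solution m A N -> nil_solution m B (Q *m N *m P).
Proof.
move=> PQ QP QAP [[k Nk0] eqN].
have conjM X Y : (Q *m X *m P) *m (Q *m Y *m P) = Q *m (X *m Y) *m P.
  by rewrite !mulmxA -[Q *m X *m P *m Q]mulmxA PQ mulmx1.
have conjX i : (Q *m N *m P) ^+ i = Q *m N ^+ i *m P.
  elim: i => [|i IHi]; first by rewrite !expr0 [1 in RHS]/(1%:M) mulmx1 QP.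
  by rewrite exprS IHi [LHS]conjM [N ^+ i.+1]exprS.
split; first by exists k; rewrite conjX Nk0 mulmx0 mul0mx.
rewrite -QAP !conjM -mulmxBl -mulmxBr eqN mulmxDr mulmxDl; congr (_ + _).
rewrite /higher_terms mulmx_sumr mulmx_suml; apply: eq_bigr => i _.
by rewrite conjX -scalemxAr -scalemxAl.
Qed.

(** The equation involves [B] through its commutator with [N] only. *)
Lemma nil_solution_shift m n (a : F) (B N : 'M[F]_n) :
  nil_solution m B N <-> nil_solution m (B - a%:M) N.
Proof.
rewrite /nil_solution mulmxBr mulmxBl mul_mx_scalar mul_scalar_mx opprB.
by rewrite addrA subrK.
Qed.

Lemma mxdiag_mul k (p : 'I_k -> nat) (M B : forall r, 'M[F]_(p r)) :
  (\mxdiag_r M r) *m (\mxdiag_r B r) = \mxdiag_r (M r *m B r).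
Proof.
rewrite -[LHS]submxblockK; apply: eq_mxblock => r s.
rewrite submxblock_mul_diag /mxdiag mxblockK.
case: eqP => [eq_rs|_]; last by rewrite mul0mx.
by subst s; rewrite !conform_mx_id.
Qed.

Lemma mxdiagX k (p : 'I_k -> nat) (M : forall r, 'M[F]_(p r)) i :
  (\mxdiag_r M r) ^+ i = \mxdiag_r (M r ^+ i).
Proof.
elim: i => [|i IHi].
  transitivity (1%:M : 'M[F]_(\sum_r p r)); first by rewrite expr0.
  by rewrite -mxdiagZ; apply: eq_mxdiag => r; rewrite expr0.
rewrite exprS IHi [LHS]mxdiag_mul; apply: eq_mxdiag => r.
by rewrite exprS.
Qed.

Lemma mxdiag_scale k (p : 'I_k -> nat) (M : forall r, 'M[F]_(p r)) c :
  c *: (\mxdiag_r M r) = \mxdiag_r (c *: M r).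
Proof.
rewrite -[LHS]submxblockK; apply: eq_mxblock => r s.
rewrite submxblockZ /mxdiag mxblockK; case: eqP => [eq_rs|_]; last exact: scaler0.
by subst s; rewrite !conform_mx_id.
Qed.

Lemma mxdiag_higher_terms m k (p : 'I_k -> nat) (M : forall r, 'M[F]_(p r)) :
  higher_terms m (\mxdiag_r M r) = \mxdiag_r (higher_terms m (M r)).
Proof.
rewrite /higher_terms; elim: (index_iota 2 m) => [|i r IHr].
  by rewrite big_nil -mxdiag0; apply: eq_mxdiag => r; rewrite big_nil.
rewrite big_cons IHr mxdiagX mxdiag_scale -mxdiagD; apply: eq_mxdiag => j.
by rewrite big_cons.
Qed.

Lemma nilpotent_mxdiag k (p : 'I_k -> nat) (M : forall r, 'M[F]_(p r)) :
  (forall r, nilpotent_mx (M r)) -> nilpotent_mx (\mxdiag_r M r).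
Proof.
move=> nilM; exists (\sum_r p r)%N; rewrite mxdiagX -mxdiag0; apply: eq_mxdiag => r.
by apply: nilpotent_expr_le => //; rewrite (bigD1 r) //= leq_addr.
Qed.

Lemma nil_solution_mxdiag m k (p : 'I_k -> nat) (B M : forall r, 'M[F]_(p r)) :
  nil_solution m (\mxdiag_r B r) (\mxdiag_r M r) <->
  forall r, nil_solution m (B r) (M r).
Proof.
rewrite /nil_solution mxdiag_higher_terms -mxdiagD !mxdiag_mul -mxdiagB.
split=> [[[e Me0] /eq_mxdiagP eqM] r|sol].
  split; last exact: eqM.
  by exists e; move: Me0; rewrite mxdiagX -mxdiag0 => /eq_mxdiagP/(_ r).
split; first by apply: nilpotent_mxdiag => r; have [] := sol r.
by apply: eq_mxdiag => r; have [] := sol r.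
Qed.

(** The entries [(i, j)] with [j < i + k] of the [k]-th power vanish. *)
Lemma nilpotent_jordan_block q : nilpotent_mx (jordan_block (0 : F) q).
Proof.
have J0 k (i j : 'I_q) : (j < i + k)%N -> (jordan_block (0 : F) q ^+ k) i j = 0.
  elim: k i => [|k IHk] i lt_ji.
    rewrite expr0 mxE; case: eqP lt_ji => // ->; by rewrite addn0 ltnn.
  rewrite exprS mxE big1 // => h _; rewrite mxE mul0rn add0r.
  case: eqP => [def_h|_]; last by rewrite mul0r.
  by rewrite IHk ?mulr0 // -def_h addSnnS.
by exists q; apply/matrixP => i j; rewrite [RHS]mxE J0 // ltn_addl.
Qed.

Lemma nilpotent_jordan_mx t : nilpotent_mx (jordan_mx (0 : F) t).
Proof. by apply: nilpotent_mxdiag => l; apply: nilpotent_jordan_block. Qed.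

Lemma chain_jordan_mxE (lam : F) c (t : nat -> seq nat) :
  chain_jordan_mx lam c t =
  \mxdiag_(j < c.+1) ((lam + j%:R)%:M + jordan_mx 0 (t j)).
Proof. by apply: eq_mxdiag => j; apply: jordan_mx_shift. Qed.

Lemma chain_jordan_mx_stair (lam : F) c (t : nat -> seq nat) :
  chain_jordan_mx lam c t - lam%:M =
  stair_mx (fun j : 'I_c.+1 => jordan_mx (0 : F) (t j)).
Proof.
rewrite chain_jordan_mxE -mxdiagZ -mxdiagB; apply: eq_mxdiag => j.
by rewrite raddfD /= addrAC [lam%:M + _]addrC addrK.
Qed.

End Transport.

Section Reduction.
Variables (F : numFieldType) (n : nat) (A : 'M[F]_n) (D : chain_decomposition A).
Hypothesis n_ge2 : (2 <= n)%N.

Let J r := chain_jordan_mx (cd_lam (c := D) r) (cd_c r) (cd_t r).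

Lemma cd_size_le : (\sum_(r < cd_m D) \sum_(j < (cd_c r).+1)
                     \sum_(l < size (cd_t r j)) nth 0%N (cd_t r j) l <= n)%N.
Proof.
rewrite -[X in (X <= _)%N](mxrank1 F) -(cd_QP D).
by rewrite (leq_trans (mxrankM_maxl _ _)) ?rank_leq_col.
Qed.

Lemma cd_chain_size_le (r : 'I_(cd_m D)) : (\sum_(j < (cd_c r).+1)
                     \sum_(l < size (cd_t r j)) nth 0%N (cd_t r j) l <= n)%N.
Proof. by apply: leq_trans cd_size_le; rewrite (bigD1 r) //= leq_addr. Qed.

(** Block diagonal matrices, as a condition on the blocks off the diagonal. *)
Definition off_blocks0 k (p : 'I_k -> nat) (M : 'M[F]_(\sum_r p r)) : Prop :=
  forall r s, r != s -> submxblock M r s = 0.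

Lemma off_blocks0E k (p : 'I_k -> nat) (M : 'M[F]_(\sum_r p r)) :
  off_blocks0 M -> M = \mxdiag_r submxblock M r r.
Proof.
move=> M0; rewrite -[LHS]submxblockK; apply: eq_mxblock => r s.
case: eqP => [eq_rs|/eqP neq]; last exact: M0.
by subst s; rewrite conform_mx_id.
Qed.

Lemma off_blocks0X k (p : 'I_k -> nat) (M : 'M[F]_(\sum_r p r)) i :
  off_blocks0 M -> off_blocks0 (M ^+ i).
Proof.
move=> /off_blocks0E -> r s neq_rs.
by rewrite mxdiagX /mxdiag mxblockK (negPf neq_rs).
Qed.

(** Different chains do not interact, because no eigenvalue of a chain is the
    successor of an eigenvalue of another chain. *)
Lemma chain_solution_diag (M : 'M[F]_(\sum_r _)) :
  nil_solution n (\mxdiag_r J r) M -> off_blocks0 M.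
Proof.
move=> solM.
have [Z [d [c [eqZ ->]]]] := linearized_solution n_ge2 cd_size_le solM.
have Z0 : off_blocks0 Z.
  move=> r s neq_rs; set X := submxblock Z r s.
  have eqX : X *m J s - J r *m X = X.
    by rewrite {3}/X -eqZ submxblockB submxblock_mul_diag submxblock_diag_mul.
  rewrite /J !chain_jordan_mxE in eqX.
  rewrite -[X]submxblockK -[0]submxblockK; apply: eq_mxblock => j j'.
  rewrite submxblock0.
  apply: (@eigen_mxblock _ _ _ _ _ (fun j => cd_lam r + j%:R)
    (fun j => cd_lam s + j%:R) _ _ _ _ _ _ _ eqX).
  - by move=> ?; apply: nilpotent_jordan_mx.
  - by move=> ?; apply: nilpotent_jordan_mx.
  apply/eqP; apply: (cd_separated (c := D) (r := s) (s := r)).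
  - by rewrite eq_sym.
  - by exists j'; rewrite // -ltnS.
  by exists j; rewrite // -ltnS.
apply: (big_ind (@off_blocks0 _ _)) => [r s _|X Y X0 Y0 r s neq|i _ r s neq].
- exact: submxblock0.
- by rewrite submxblockD X0 ?Y0 ?addr0.
by rewrite submxblockZ off_blocks0X ?scaler0.
Qed.

Lemma nil_solution_chains (N : 'M[F]_n) :
  nil_solution n A N <->
  exists Nr, cd_Q D *m N *m cd_P D = \mxdiag_r Nr r /\
    forall r, nil_solution n (J r) (Nr r).
Proof.
split=> [solN|[Nr [defN solNr]]].
  have solM := nil_solution_conj (cd_PQ D) (cd_QP D) (cd_similar D) solN.
  have eqM := off_blocks0E (chain_solution_diag solM).
  exists (fun r => submxblock (cd_Q D *m N *m cd_P D) r r); split=> //.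
  by move: solM; rewrite {1}eqM => /nil_solution_mxdiag.
have /nil_solution_mxdiag solM := solNr; rewrite -defN in solM.
have PJQ : cd_P D *m (\mxdiag_r J r) *m cd_Q D = A.
  rewrite -(cd_similar D) !mulmxA cd_PQ mul1mx -mulmxA cd_PQ mulmx1 //.
have := nil_solution_conj (cd_QP D) (cd_PQ D) PJQ solM.
by rewrite !mulmxA cd_PQ mul1mx -mulmxA cd_PQ mulmx1.
Qed.

(** The [r]-th diagonal block is computed from its seeds [x1 r], after
    subtracting the scalar [cd_lam r]. *)
Lemma nil_solution_chains_successive (N : 'M[F]_n) :
  nil_solution n A N <->
  exists x1 : (forall (r : 'I_(cd_m D)) (j j' : 'I_(cd_c r).+1),
      'M[F]_(\sum_(l < size (cd_t r j)) nth 0%N (cd_t r j) l,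
             \sum_(l < size (cd_t r j')) nth 0%N (cd_t r j') l)),
    (forall r, valid_seeds
       (fun j : 'I_(cd_c r).+1 => jordan_mx (0 : F) (cd_t r j)) (x1 r)) /\
    N = cd_P D *m
        (\mxdiag_(r < cd_m D) successive_mx n
           (fun j : 'I_(cd_c r).+1 => jordan_mx (0 : F) (cd_t r j))
           (x1 r) (cd_c r)) *m cd_Q D.
Proof.
have nilJ r (j : 'I_(cd_c r).+1) := nilpotent_jordan_mx F (cd_t (c := D) r j).
have chainE r M : nil_solution n (J r) M <->
    exists x1, valid_seeds (fun j : 'I_(cd_c r).+1 => jordan_mx (0 : F) (cd_t r j)) x1 /\
      M = successive_mx n (fun j : 'I_(cd_c r).+1 => jordan_mx (0 : F) (cd_t r j))
            x1 (cd_c r).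
  rewrite (nil_solution_shift _ (cd_lam r)) chain_jordan_mx_stair.
  rewrite (nil_solution_successive (nilJ r) M n_ge2 (cd_chain_size_le r)).
  by rewrite subSS subn0.
rewrite nil_solution_chains; split=> [[Nr [defN solNr]]|[x1 [x1_valid defN]]].
  have x1P r := iffLR (chainE r (Nr r)) (solNr r).
  exists (fun r => projT1 (cid (x1P r))); split=> [r|].
    by have [] := projT2 (cid (x1P r)).
  rewrite -(eq_mxdiag (B_ := Nr)) => [|r]; last by have [] := projT2 (cid (x1P r)).
  by rewrite -defN !mulmxA cd_PQ mul1mx -mulmxA cd_PQ mulmx1.
exists (fun r => successive_mx n (fun j : 'I_(cd_c r).+1 => jordan_mx (0 : F) (cd_t r j))
    (x1 r) (cd_c r)); split.
  by rewrite defN !mulmxA cd_QP mul1mx -mulmxA cd_QP mulmx1.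
by move=> r; apply/chainE; exists (x1 r).
Qed.

End Reduction.

(** * The general solution and its computation *)

Unset Implicit Arguments.

Theorem proposition4 (R : realType) (n : nat) (hn : (2 <= n)%N)
    (A : 'M[R[i]]_n) :
  (* the general solution *)
  (forall X : 'M[R[i]]_n,
     (no_eigenvalue_Rminus X /\ is_logmx X (X *m A - A *m X)) <->
     exists N : 'M[R[i]]_n,
       [/\ X = 1%:M + N,
           nilpotent_mx N
         & N *m A - A *m N =
           N + \sum_(2 <= i < n) ((-1) ^+ (i - 1) / i%:R) *: N ^+ i]) /\
  (* the calculation of N: a decomposition of A exists, *)
  inhabited (chain_decomposition A) /\
  (* every decomposition reduces the problem to its chains, and the
     calculation yields exactly the solutions N, *)
  (forall D : chain_decomposition A,
     [/\ forall N : 'M[R[i]]_n,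
           nil_solution n A N <->
           exists Nr : (forall r : 'I_(cd_m D),
               'M[R[i]]_(\sum_(j < (cd_c r).+1)
                  \sum_(l < size (cd_t r j)) nth 0%N (cd_t r j) l)),
             cd_Q D *m N *m cd_P D = \mxdiag_(r < cd_m D) Nr r /\
             forall r, nil_solution n
               (chain_jordan_mx (cd_lam r) (cd_c r) (cd_t r)) (Nr r),
         forall (r : 'I_(cd_m D))
             (M : 'M[R[i]]_(\sum_(j < (cd_c r).+1)
                  \sum_(l < size (cd_t r j)) nth 0%N (cd_t r j) l)),
           nil_solution n (chain_jordan_mx (cd_lam r) (cd_c r) (cd_t r)) M <->
           nil_solution n
             (chain_jordan_mx (cd_lam r) (cd_c r) (cd_t r) - (cd_lam r)%:M) M,
         forall r : 'I_(cd_m D),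
           chain_jordan_mx (cd_lam r) (cd_c r) (cd_t r) - (cd_lam r)%:M =
             stair_mx (fun j : 'I_(cd_c r).+1 =>
                         jordan_mx (0 : R[i]) (cd_t r j)) /\
           forall j : 'I_(cd_c r).+1,
             nilpotent_mx (jordan_mx (0 : R[i]) (cd_t r j))
       & forall N : 'M[R[i]]_n,
           nil_solution n A N <->
           exists x1 : (forall (r : 'I_(cd_m D)) (j j' : 'I_(cd_c r).+1),
               'M[R[i]]_(\sum_(l < size (cd_t r j)) nth 0%N (cd_t r j) l,
                         \sum_(l < size (cd_t r j')) nth 0%N (cd_t r j') l)),
             (forall r, valid_seeds
                (fun j : 'I_(cd_c r).+1 => jordan_mx (0 : R[i]) (cd_t r j))
                (x1 r)) /\
             N = cd_P D *m
                 (\mxdiag_(r < cd_m D) successive_mx n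
                    (fun j : 'I_(cd_c r).+1 => jordan_mx (0 : R[i]) (cd_t r j))
                    (x1 r) (cd_c r)) *m cd_Q D]) /\
  (* where diag(nu_0, I + nu_1, ...) is treated by successive Sylvester
     equations *)
  (forall (k : nat) (s : 'I_k -> nat) (nu : forall j : 'I_k, 'M[R[i]]_(s j)),
     (\sum_j s j <= n)%N -> (forall j, nilpotent_mx (nu j)) ->
     [/\ forall N : 'M[R[i]]_(\sum_j s j),
           nil_solution n (stair_mx nu) N <-> sylvester_system n nu N,
         forall (i : nat) (j j' : 'I_k) (psi x : 'M[R[i]]_(s j, s j')),
           (2 <= i)%N -> j' = (j + i)%N :> nat ->
           (sylvester_mx (((i - 1)%:R : R[i])%:M + nu j') (nu j) x = psi <->
            x = neumann_mx (nu j) (nu j') (i - 1) psi)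
       & forall N : 'M[R[i]]_(\sum_j s j),
           nil_solution n (stair_mx nu) N <->
           exists x1 : (forall j j' : 'I_k, 'M[R[i]]_(s j, s j')),
             valid_seeds nu x1 /\ N = successive_mx n nu x1 (k - 1)]).
Proof.
split; first by move=> X; apply: log_equation.
split; first by case: n hn A => [//|n'] _ A; apply: chain_decomposition_exists.
split=> [D|k s nu le_sn nil_nu].
  split=> [N|r M|r|N].
  - exact: nil_solution_chains.
  - exact: nil_solution_shift.
  - split; first exact: chain_jordan_mx_stair.
    by move=> j; apply: nilpotent_jordan_mx.
  exact: nil_solution_chains_successive.
split=> [N|i j j' psi x i_ge2 _|N].
- exact: nil_solution_sylvester.
- by apply: sylvester_neumann; rewrite ?subn_gt0.
exact: nil_solution_successive.
Qed.
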